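(* For every $\gamma\ge 0$ there exists $n_0(\gamma)$ (depending only on $\gamma$) such that the following holds. In the fixed-design regression framework described in the context, assume that $\mathcal M$ is finite, that $\mathcal M$ contains at least one model of dimension at most $n/20$, that there exists $m_1\in\mathcal M$ with $S_{m_1}=\mathbb R^n$, and that $\varepsilon\sim\mathcal N(0,\sigma^2 I_n)$. If $n\ge n_0(\gamma)$, then with probability at least $1-4\,\mathrm{card}(\mathcal M)\,n^{-\gamma}$ the following inequalities hold simultaneously: $$\forall C\le(1-\eta_n^-)\sigma^2,\quad D_{\widehat m(C)}\ge \frac{9n}{10};$$ $$\forall C\le(1-\eta_n^-)\sigma^2,\quad \frac1n\|\widehat F_{\widehat m(C)}-F\|^2\ge\frac{7\sigma^2}{8};$$ $$\forall C\ge(1+\eta_n^+)\sigma^2,\quad D_{\widehat m(C)}\le\frac{n}{10};$$ $$\forall C>\sigma^2,\quad \frac1n\|\widehat F_{\widehat m(C)}-F\|^2\le h\!\left(\frac{C}{\sigma^2}\right)\left[\inf_{m\in\mathcal M}\left\{\frac1n\|\widehat F_m-F\|^2\right\}+\frac{20\sigma^2\gamma\log(n)}{n}\right];$$ and for every $\eta\in(0,1/2]$ and every $C\in[(2-\eta)\sigma^2,(2+\eta)\sigma^2]$, $$\frac1n\|\widehat F_{\widehat m(C)}-F\|^2\le(1+3\eta)\inf_{m\in\mathcal M}\left\{\frac1n\|\widehat F_m-F\|^2\right\}+\frac{880\,\sigma^2\gamma\log(n)}{\eta\, n};$$ where $$\sigma^2\eta_n^+=40\inf_{m\in\mathcal M,\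 D_m\le n/20}\left\{\frac1n\|(I_n-\Pi_m)F\|^2\right\}+82\,\sigma^2\sqrt{\frac{\gamma\log(n)}{n}},\qquad \eta_n^-=41\sqrt{\frac{\gamma\log(n)}{n}},$$ $$\forall u>1,\quad h(u)=\frac{10}{(u-1)^4}\mathbf 1_{u\in(1,2)}+u^3\,\mathbf 1_{u\ge2}.$$ (Here $C$ always ranges over nonnegative reals.)
   Context: Framework: one observes $Y=F+\varepsilon\in\mathbb R^n$, where $F\in\mathbb R^n$ is deterministic and $\varepsilon_1,\dots,\varepsilon_n$ are i.i.d. with mean $0$ and variance $\sigma^2>0$. $\|\cdot\|$ is the Euclidean norm on $\mathbb R^n$ and $I_n$ the identity matrix. $(S_m)_{m\in\mathcal M}$ is a (deterministic) collection of linear subspaces of $\mathbb R^n$, called models. For $m\in\mathcal M$, $\Pi_m$ is the orthogonal projection of $\mathbb R^n$ onto $S_m$, $D_m=\dim(S_m)$, and $\widehat F_m=\Pi_mY$ is the least-squares estimator on $S_m$. For every $C\ge0$, $\widehat m(C)$ denotes a minimizer $$\widehat m(C)\in\operatorname*{argmin}_{m\in\mathcal M}\left\{\frac1n\|\widehat F_m-Y\|^2+C\,\frac{D_m}{n}\right\}.$$ *)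

(* Defs.v *)
From HB Require Import structures.
From mathcomp Require Import all_boot all_order all_algebra.
From mathcomp Require Import all_classical all_reals all_analysis.

Set Implicit Arguments.
Unset Strict Implicit.
Unset Printing Implicit Defensive.

Import Order.TTheory GRing.Theory Num.Theory.

Local Open Scope classical_set_scope.
Local Open Scope ring_scope.

Section Euclidean.
Variables (R : realType) (n : nat).
Implicit Types (u v x y : 'cV[R]_n) (S : {vspace 'cV[R]_n}).

Definition dotcv u v : R := \sum_i u i 0 * v i 0.

(* The library's norm `|x| on 'cV[R]_n is the sup norm. *)
Definition enorm u : R := Num.sqrt (dotcv u u).

Lemma dotcvC u v : dotcv u v = dotcv v u.
Proof. by apply: eq_bigr => i _; rewrite mulrC. Qed.

Lemma dotcvDl a u v x : dotcv (a *: u + v) x = a * dotcv u x + dotcv v x.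
Proof.
rewrite mulr_sumr -big_split; apply: eq_bigr => i _ /=.
by rewrite !mxE mulrDl mulrA.
Qed.

Lemma dotcvDr a u v x : dotcv x (a *: u + v) = a * dotcv x u + dotcv x v.
Proof. by rewrite dotcvC dotcvDl !(dotcvC x). Qed.

Lemma dotcv_gt0 u : u != 0 -> 0 < dotcv u u.
Proof.
have u2_ge0 i : 0 <= u i 0 * u i 0 by rewrite -expr2 sqr_ge0.
move=> u0; rewrite lt_neqAle sumr_ge0 1?eq_sym ?andbT; last by move=> i _.
apply: contra u0 => /eqP/psumr_eq0P u2_eq0; apply/eqP/matrixP => i j.
by rewrite ord1 mxE; apply/eqP; rewrite -[_ == 0]orbb -mulf_eq0 u2_eq0.
Qed.

HB.instance Definition _ := bilinear_isBilinear.Build R _ _ _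
  (GRing.Scale.Law.clone _ _ *%R _)
  (GRing.Scale.Law.clone _ _ (idfun \; *%R) _) dotcv
  (conj (fun x a u v => dotcvDl a u v x) (fun x a u v => dotcvDr a u v x)).

Let dotcv_herm u v : dotcv u v = (-1) ^+ false * idfun (dotcv v u).
Proof. by rewrite expr0 mul1r dotcvC. Qed.

HB.instance Definition _ :=
  @isHermitianSesquilinear.Build R _ false idfun dotcv dotcv_herm.

HB.instance Definition _ := @isDotProduct.Build R _ dotcv dotcv_gt0.

Local Notation dotform := (dotcv : {symmetric 'cV[R]_n}).

Definition orthproj S : 'End('cV[R]_n) := daddv_pi S (orthov dotform S).

Lemma capv_orth S : (S :&: orthov dotform S = 0)%VS.
Proof.
apply/eqP; rewrite -subv0; apply/subvP => u; rewrite memv_cap => /andP[uS].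
move=> /mem_orthovP/(_ u uS) uu0; rewrite memv0; apply: contraTT isT => u0.
by have := dotcv_gt0 u0; rewrite [dotcv u u]uu0 ltxx.
Qed.

Lemma addv_orth S : (S + orthov dotform S = fullv)%VS.
Proof.
pose B := \matrix_(i < \dim S, j < n) ((vbasis S)`_i j 0).
pose f := linfun (mulmx B : 'cV[R]_n -> 'cV[R]_(\dim S)).
have kerf : (lker f <= orthov dotform S)%VS.
  apply/subvP => x; rewrite memv_ker lfunE /= => /eqP Bx0.
  apply/mem_orthovP => v /coord_vbasis ->; rewrite linear_sumr big1 // => i _.
  rewrite linearZr /= -[RHS](mulr0 (coord (vbasis S) i v)); congr (_ * _).
  have := congr1 (fun A : 'cV_(\dim S) => A i 0) Bx0; rewrite !mxE => <-.
  by apply: eq_bigr => j _; rewrite !mxE mulrC.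
apply/eqP; rewrite eqEdim subvf dimv_disjoint_sum ?capv_orth //=.
rewrite -(limg_ker_dim f fullv) capfv addnC leq_add ?(dimvS kerf) //.
by have := dimvS (subvf (f @: fullv)); rewrite dimvf dim_matrix mulr1.
Qed.

Lemma orthproj_mem S x : orthproj S x \in S.
Proof. exact: memv_pi. Qed.

Lemma orthproj_orth S x y : y \in S -> dotcv (x - orthproj S x) y = 0.
Proof.
move=> yS; rewrite /orthproj -[X in X - _](daddv_pi_add (capv_orth S)).
  by rewrite addrAC subrr add0r; apply/mem_orthovP/yS; exact: memv_pi.
by rewrite addv_orth memvf.
Qed.

End Euclidean.

Section Probability.
Local Open Scope ereal_scope.
Context d (T : measurableType d) (R : realType) (P : probability T R).

Definition mutually_independent (I : finType) (X : I -> {RV P >-> R}) : Prop :=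
  forall (J : {set I}) (B : I -> set R),
    (forall i, i \in J -> measurable (B i)) ->
    P (\bigcap_(i in [set` J]) X i @^-1` B i) =
    \prod_(i in J) P (X i @^-1` B i).

(* The second argument of normal_prob is the standard deviation. *)
Definition iid_gaussian (n : nat) (sigma : R) (eps : 'I_n -> {RV P >-> R}) :
    Prop :=
  mutually_independent eps /\
  forall i B, measurable B ->
    distribution P (eps i) B = normal_prob 0 sigma B.

End Probability.

Section Regression.
Variables (R : realType) (n : nat) (M : finType).
Variables (S : M -> {vspace 'cV[R]_n}).

Definition dimension (m : M) : R := (\dim (S m))%:R.

Definition least_squares (m : M) (y : 'cV[R]_n) : 'cV[R]_n := orthproj (S m) y.

Definition emp_risk (m : M) (y : 'cV[R]_n) : R :=
  enorm (least_squares m y - y) ^+ 2 / n%:R.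

Definition criterion (C : R) (y : 'cV[R]_n) (m : M) : R :=
  emp_risk m y + C * (dimension m / n%:R).

Definition argmin_criterion (C : R) (y : 'cV[R]_n) : set M :=
  [set m | forall m', criterion C y m <= criterion C y m'].

Variable F : 'cV[R]_n.

Definition risk (m : M) (y : 'cV[R]_n) : R :=
  enorm (least_squares m y - F) ^+ 2 / n%:R.

Definition oracle_risk (y : 'cV[R]_n) : R := inf [set risk m y | m in [set: M]].

Definition bias (m : M) : R := enorm ((\1 - orthproj (S m))%VF F) ^+ 2 / n%:R.

Definition eta_minus (gamma : R) : R :=
  41 * Num.sqrt (gamma * ln n%:R / n%:R).

Definition eta_plus (sigma gamma : R) : R :=
  (40 * inf [set bias m | m in [set m | dimension m <= n%:R / 20]]
   + 82 * sigma ^+ 2 * Num.sqrt (gamma * ln n%:R / n%:R)) / sigma ^+ 2.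

End Regression.

Definition slope_factor (R : realType) (u : R) : R :=
  10 / (u - 1) ^+ 4 * \1_(`]1, 2[%classic) u + u ^+ 3 * \1_(`[2, +oo[%classic) u.

(* Main.v *)
Require Import Defs.
From mathcomp Require Import all_boot all_order all_algebra.
From mathcomp Require Import all_classical all_reals all_analysis.
From mathcomp Require Import measurable_realfun ring lra.

(** Write Y = F + E with E the Gaussian noise, S for a model of dimension D,
    B for the squared norm of F minus its projection on S, V for the squared
    norm of the projection of E on S, and G for the scalar product of E with
    F minus its projection. By orthogonality (risk_decomposition and
    criterion_decomposition), n times the risk is B + V and n times the
    criterion is B + 2 G - V + C D + |E|^2. As V is close to sigma^2 D and G is
    small compared with B, the criterion behaves like B + (C - sigma^2) D: below
    sigma^2 it is minimized by the largest models, above sigma^2 it penalizes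
    the dimension, and at 2 sigma^2 it reproduces the risk.

    These approximations hold off an event of small probability. With
    x = gamma ln n and n^(- gamma) = exp (- x), each of the following holds up to
    probability exp (- x): the upper bounds sigma sqrt (2 x B) on G and on - G,
    and the two chi-square bounds
      D - 2 sqrt (D x) <= V / sigma^2 <= D + 2 sqrt (D x) + 2 x.
    They are Chernoff bounds (linear_tail, sqr_proj_upper_tail,
    sqr_proj_lower_tail). The moment generating functions that they use come
    from a single formula, gaussian_exp_quadratic_along: the square of a linear
    form is linearized by an auxiliary standard normal variable, integrals of
    positive functions are exchanged, and what remains is a product of
    one-dimensional Gaussian integrals by independence of the coordinates. The
    lower bound on V is reduced to projections with a positive sign by
    - V = - |E|^2 + |E - P E|^2, P E being the projection of E.

    On the complement of the union over the models of these events, everything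
    is deterministic: the minimality of the selected model gives one inequality
    between its criterion and that of a competitor, and the five conclusions
    follow by arithmetic (small_penalty_dimension, large_dimension_risk,
    large_penalty_dimension, slope_risk, near_two_risk). The competitor is the
    full space, the small model with least bias, or the oracle model. The
    threshold n0 makes sqrt (x / n) at most 1 / 80. *)

Set Implicit Arguments.
Unset Strict Implicit.
Unset Printing Implicit Defensive.

Import Order.TTheory GRing.Theory Num.Theory.
Import numFieldNormedType.Exports.

Local Open Scope classical_set_scope.
Local Open Scope ring_scope.

(** * Elementary bounds on the exponential *)

Section ExpInequalities.
Variable R : realType.
Implicit Types (f df : R -> R) (s t x : R).

Lemma ge0_from_derive f df : (forall x, is_derive x 1 f (df x)) ->
  (forall x, 0 < x -> 0 <= df x) -> 0 <= f 0 -> forall x, 0 <= x -> 0 <= f x.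
Proof.
move=> fdf df0 f0 x; rewrite le_eqVlt => /predU1P[<- //|x0].
have fc : {within `[0, x], continuous f}.
  by apply: derivable_within_continuous => y _; apply: ex_derive.
have [c c0x] := MVT x0 (fun y _ => fdf y) fc.
rewrite in_itv/= in c0x; case/andP: c0x => c0 _.
have := mulr_ge0 (df0 c c0) (ltW x0); rewrite subr0; lra.
Qed.

Lemma sinh_ge t : 0 <= t -> 2 * t <= expR t - expR (- t).
Proof.
move=> t0; rewrite -subr_ge0.
pose f : R -> R := expR - (expR \o -%R) - (2 \*: id).
pose df t := expR t + expR (- t) - 2.
have fdf (y : R) : is_derive y 1 f (df y).
  by apply: is_derive_eq; rewrite /df mulrN1 opprK scaler1.
have df0 y : 0 < y -> 0 <= df y.
  move=> y0; rewrite /df expRN.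
  have e0 := expR_gt0 y; set e := expR y in e0 *.
  have : 0 <= (e - 1) ^+ 2 / e by rewrite divr_ge0 ?sqr_ge0 ?ltW.
  have -> : (e - 1) ^+ 2 / e = e + e^-1 - 2 by field; rewrite gt_eqF.
  by [].
apply: (ge0_from_derive fdf df0) => //.
by rewrite /f !fctE /= oppr0 subrr scaler0 subr0.
Qed.

(** The function (1 + s) exp (s^2 / 2 - s) is 1 at 0, with derivative
    s^2 exp (s^2 / 2 - s). *)
Lemma expR_le1D s : 0 <= s -> expR (s - s ^+ 2 / 2) <= 1 + s.
Proof.
move=> s0.
pose f : R -> R := (cst 1 + id) * (expR \o (2^-1 \*: (id ^+ 2) - id)) - cst 1.
pose df s := s ^+ 2 * expR (2^-1 * s ^+ 2 - s).
have fdf (y : R) : is_derive y 1 f (df y).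
  apply: is_derive_eq; rewrite /df !fctE /= /GRing.scale /=; by field.
have df0 y : 0 < y -> 0 <= df y by move=> _; rewrite mulr_ge0 ?sqr_ge0 ?expR_ge0.
have f0 : 0 <= f 0.
  by rewrite /f !fctE /= expr0n/= scaler0 subr0 expR0 addr0 mulr1 subrr.
have := ge0_from_derive fdf df0 f0 s0.
rewrite /f !fctE /= subr_ge0 => h.
have -> : s - s ^+ 2 / 2 = - (2^-1 *: s ^+ 2 - s) by rewrite opprB mulrC.
by rewrite expRN -div1r ler_pdivrMr ?expR_gt0.
Qed.

(** With y = 1 / (1 - s), the exponent is (y - 1 / y) / 2 = sinh (ln y). *)
Lemma inv_le_expR s : 0 <= s < 1 ->
  (1 - s)^-1 <= expR (s + s ^+ 2 / (2 * (1 - s))).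
Proof.
move=> /andP[s0 s1]; have s10 : 0 < 1 - s by rewrite subr_gt0.
have y1 : 1 <= (1 - s)^-1 by rewrite invf_ge1// gerBl.
have := sinh_ge (ln_ge0 y1); rewrite expRN lnK ?posrE ?invr_gt0// invrK => h.
rewrite -[leLHS]lnK ?posrE ?invr_gt0// ler_expR -(ler_pM2l (ltr0n _ 2)).
apply: le_trans h _; rewrite le_eqVlt; apply/orP; left; apply/eqP.
by field; rewrite gt_eqF.
Qed.

End ExpInequalities.

(** * Integration against a weighted image measure *)

Section WeightedPushforward.
Local Open Scope ereal_scope.
Context d1 d2 (X : measurableType d1) (Y : measurableType d2) (R : realType).
Variables (mu : {measure set X -> \bar R}) (nu : {measure set Y -> \bar R}).
Variables (phi : X -> Y) (Z : X -> R).
Hypotheses (mphi : measurable_fun setT phi) (mZ : measurable_fun setT Z).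
Hypothesis Z_ge0 : forall x, (0 <= Z x)%R.
Hypothesis ZE : forall B, measurable B ->
  \int[mu]_x (Z x * \1_B (phi x))%:E = nu B.

Import HBNNSimple.

Let weighted_nnsfun (g : {nnsfun Y >-> R}) :
  \int[mu]_x (Z x * g (phi x))%:E = \int[nu]_y (g y)%:E.
Proof.
have mg r : measurable (g @^-1` [set r]) by [].
have mind r : measurable_fun setT (fun x => \1_(g @^-1` [set r]) (phi x) : R).
  exact: (measurableT_comp (measurable_indic _)).
have r0 r y : 0 <= (r * \1_(g @^-1` [set r]) y)%:E.
  by rewrite EFinM nnfun_muleindic_ge0.
transitivity (\sum_(r \in range g) r%:E * nu (g @^-1` [set r])).
  under eq_integral.
    move=> x _; rewrite EFinM fimfunE -fsumEFin// ge0_mule_fsumr//.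
    over.
  rewrite ge0_integral_fsum//=; last 2 first.
  - move=> r; apply: emeasurable_funM; apply/measurable_EFinP => //.
    exact: measurable_funM.
  - by move=> r x _; apply: mule_ge0; [rewrite lee_fin|exact: r0].
  apply: eq_fsbigr => r /[!inE] -[y _ gy].
  under eq_integral do rewrite -EFinM mulrCA EFinM.
  rewrite ge0_integralZl//; first by rewrite ZE.
  - by apply/measurable_EFinP/measurable_funM.
  - by move=> x _; rewrite lee_fin mulr_ge0.
  - by rewrite -gy lee_fin.
under eq_integral do rewrite fimfunE -fsumEFin//.
rewrite ge0_integral_fsum//=; last first.
- by move=> r; apply/measurable_EFinP/measurable_funM.
apply: eq_fsbigr => r _.
by rewrite integralZl_indic_nnsfun// integral_indic// setIT.
Qed.

(** Two sides that agree on indicator functions agree on nonnegative functions,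
    by linearity and monotone convergence. With phi = id and Z a density this is
    integration against a measure with density; with Z a product of functions of
    other random variables it is the step of an independence argument. *)
Lemma ge0_integral_weighted_pushforward (f : Y -> R) :
  measurable_fun setT f -> (forall y, (0 <= f y)%R) ->
  \int[mu]_x (Z x * f (phi x))%:E = \int[nu]_y (f y)%:E.
Proof.
move=> mf f0.
have mF : measurable_fun setT (EFin \o f) by exact/measurable_EFinP.
pose f_ := nnsfun_approx measurableT mF.
have mf_ n : measurable_fun setT (f_ n : Y -> R) by [].
transitivity (limn (fun n => \int[mu]_x (Z x * f_ n (phi x))%:E)); last first.
  under eq_fun do rewrite weighted_nnsfun.
  rewrite -monotone_convergence//.
  - apply: eq_integral => y _; apply/cvg_lim => //.
    by apply: (cvg_nnsfun_approx measurableT mF) => // z _; rewrite lee_fin.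
  - by move=> n; exact/measurable_EFinP.
  - by move=> n y _; rewrite lee_fin.
  - by move=> y _ m n mn; rewrite lee_fin; exact/lefP/nd_nnsfun_approx.
rewrite -monotone_convergence//.
- apply: eq_integral => x _; apply/esym/cvg_lim => //.
  under eq_fun do rewrite EFinM; rewrite EFinM.
  apply: cvgeZl => //.
  by apply: (cvg_nnsfun_approx measurableT mF) => // z _; rewrite lee_fin.
- move=> n; apply/measurable_EFinP/measurable_funM => //.
  exact: measurableT_comp.
- by move=> n x _; rewrite lee_fin mulr_ge0.
- move=> x _ m n mn; rewrite lee_fin ler_wpM2l//; exact/lefP/nd_nnsfun_approx.
Qed.

End WeightedPushforward.

(** * Products of independent variables and Gaussian integrals *)

Section Independence.
Context d (T : measurableType d) (R : realType) (P : probability T R).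
Variables (I : finType) (X : I -> {RV P >-> R}).
Hypothesis X_indep : mutually_independent X.

(** Independence is the case of indicator functions. The indicators are turned
    into general functions one index at a time: s lists the indices where f may
    already be arbitrary, and the other factors serve as the weight Z. *)
Lemma expectation_prod_indep (f : I -> R -> R) (c : I -> R) :
  (forall i, measurable_fun setT (f i)) -> (forall i y, 0 <= f i y) ->
  (forall i, \int[P]_w (f i (X i w))%:E = (c i)%:E)%E ->
  (\int[P]_w (\prod_i f i (X i w))%:E = (\prod_i c i)%:E)%E.
Proof.
suff: forall (s : seq I) (f : I -> R -> R) (c : I -> R),
  (forall i, measurable_fun setT (f i)) ->
  (forall i y, 0 <= f i y) ->
  (forall i, \int[P]_w (f i (X i w))%:E = (c i)%:E)%E ->
  (forall i, i \notin s -> exists2 B, measurable B & f i = \1_B) ->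
  (\int[P]_w (\prod_i f i (X i w))%:E = (\prod_i c i)%:E)%E.
  move=> gen mf f0 fc; apply: (gen (enum I)) => // i.
  by rewrite mem_enum.
move=> {f c}; elim=> [|j s IHs] f c mf f0 fc fB.
  have /choice[B BP] : forall i, exists B, measurable B /\ f i = \1_B.
    by move=> i; have [B] := fB i isT; exists B.
  have mB i : measurable (X i @^-1` B i).
    by rewrite -[X in measurable X]setTI; apply: measurable_funPT; case: (BP i).
  have fE w : \prod_i f i (X i w) = \1_(\bigcap_i (X i @^-1` B i)) w.
    rewrite indicE; have [wB|wB] := boolP (w \in _).
      rewrite big1// => i _; have [_ ->] := BP i.
      by rewrite indicE mem_set//; move: wB; rewrite inE; exact.
    have [i wi] : exists i, ~ B i (X i w).
      by apply/existsNP => h; move: wB; rewrite notin_setE; apply=> i _; exact: h.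
    rewrite (bigD1 i)//=; have [_ ->] := BP i.
    by rewrite indicE memNset// mul0r.
  under eq_integral do rewrite fE.
  have mcap : measurable (\bigcap_i (X i @^-1` B i)).
    by apply: fin_bigcap_measurable.
  rewrite integral_indic// setIT.
  have := @X_indep [set: I]%SET B (fun i _ => (BP i).1).
  have -> : [set` [set: I]%SET] = [set: I].
    by apply/seteqP; split => i //= _; rewrite inE.
  move=> PE; apply: etrans PE _.
  rewrite -prodEFin; apply: eq_big => [i|i _]; first by rewrite inE.
  rewrite -fc; have [_ ->] := BP i.
  under eq_integral do rewrite -[\1_ _ _]/(\1_(X i @^-1` B i) _).
  by rewrite integral_indic// setIT.
have c0 i : 0 <= c i.
  by rewrite -lee_fin -fc; apply: integral_ge0 => w _; rewrite lee_fin.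
pose Z w := \prod_(i | i != j) f i (X i w).
have mfX i : measurable_fun setT (fun w => f i (X i w)).
  exact: measurableT_comp.
have mZ : measurable_fun setT Z.
  rewrite /Z; under eq_fun do rewrite -big_filter.
  by apply: measurable_prod => i _.
have Z0 w : 0 <= Z w by apply: prodr_ge0.
have C0 : 0 <= \prod_(i | i != j) c i by apply: prodr_ge0.
have ZE (B : set R) : measurable B -> (\int[P]_w (Z w * \1_B (X j w))%:E =
    mscale (NngNum C0) (distribution P (X j)) B)%E.
  move=> mB; pose f' i := if i == j then \1_B else f i.
  pose c' i := if i == j then fine (P (X j @^-1` B)) else c i.
  have mXB : measurable (X j @^-1` B).
    by rewrite -[Y in measurable Y]setTI; apply: measurable_funPT.
  have -> : (fun w => (Z w * \1_B (X j w))%:E) =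
      (fun w => (\prod_i f' i (X i w))%:E).
    apply/funext => w; congr EFin; rewrite [RHS](bigD1 j)//= {1}/f' eqxx mulrC.
    by congr (_ * _); apply: eq_bigr => i /negbTE ij; rewrite /f' ij.
  rewrite (IHs f' c').
  - rewrite (bigD1 j)//= {1}/c' eqxx /mscale/= EFinM fineK ?fin_num_measure//.
    rewrite muleC; congr (_ * _)%E; congr EFin.
    by apply: eq_bigr => i /negbTE ij; rewrite /c' ij.
  - by move=> i; rewrite /f'; case: ifP.
  - by move=> i y; rewrite /f'; case: ifP.
  - move=> i; rewrite /f' /c'; case: ifP => // /eqP ->.
    under eq_integral do rewrite -[\1_ _ _]/(\1_(X j @^-1` B) _).
    by rewrite integral_indic// setIT fineK ?fin_num_measure.
  - move=> i si; rewrite /f'; case: ifP => [_|ij]; first by exists B.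
    by apply: fB; rewrite inE ij.
have -> : (fun w => (\prod_i f i (X i w))%:E) = (fun w => (Z w * f j (X j w))%:E).
  by apply/funext => w; rewrite (bigD1 j)//= mulrC.
rewrite (ge0_integral_weighted_pushforward _ mZ Z0 ZE)//.
have mfj : measurable_fun setT (EFin \o f j) by exact/measurable_EFinP.
rewrite ge0_integral_mscale//=; last by move=> y _; rewrite lee_fin.
rewrite ge0_integral_distribution//; last by move=> y; rewrite lee_fin.
by rewrite [X in (_ * X)%E]fc -EFinM [in RHS](bigD1 j)//= mulrC.
Qed.

End Independence.

Section GaussianIntegral.
Variable R : realType.
Implicit Types (s a b : R).

(** Completing the square: the integrand times the normal density is, up to the
    constant on the right, the density of another normal law, of mean b t and
    variance t = s^2 / (1 + 2 a s^2). *)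
Lemma normal_exp_quadratic s a b : 0 < s -> 0 < 1 + 2 * a * s ^+ 2 ->
  (\int[normal_prob 0 s]_y (expR (b * y - a * y ^+ 2))%:E =
   ((Num.sqrt (1 + 2 * a * s ^+ 2))^-1 *
     expR (s ^+ 2 / (1 + 2 * a * s ^+ 2) * b ^+ 2 / 2))%:E)%E.
Proof.
move=> s0 k0; set k := 1 + _ in k0 *; set t := s ^+ 2 / k.
have s2 : 0 < s ^+ 2 by rewrite exprn_gt0.
have t0 : 0 < t by rewrite divr_gt0.
have q0 : 0 < Num.sqrt t by rewrite sqrtr_gt0.
have mf : measurable_fun setT (fun y => expR (b * y - a * y ^+ 2)).
  apply: measurableT_comp => //.
  by apply: measurable_funB; apply: measurable_funM.
have ZE (B : set R) : measurable B ->
    (\int[lebesgue_measure]_x (normal_pdf 0 s x * \1_B x)%:E = normal_prob 0 s B)%E.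
  move=> mB; rewrite /normal_prob [RHS]integral_mkcond.
  apply: eq_integral => x _; rewrite patchE indicE; case: ifP => _.
    by rewrite mulr1.
  by rewrite mulr0.
rewrite -(ge0_integral_weighted_pushforward (mu := lebesgue_measure)
  (phi := id) (@measurable_id _ _ _)
  (measurable_normal_pdf 0 s) (normal_pdf_ge0 0 s) ZE)//.
have -> : (fun x => (normal_pdf 0 s x * expR (b * x - a * x ^+ 2))%:E) =
    (fun x => (((Num.sqrt k)^-1 * expR (t * b ^+ 2 / 2))%:E *
      (normal_pdf (b * t) (Num.sqrt t) x)%:E)%E).
  apply/funext => x; rewrite -EFinM; congr EFin.
  rewrite !normal_pdfE ?gt_eqF// /normal_peak /normal_fun.
  have -> : Num.sqrt (s ^+ 2 * pi *+ 2) =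
      Num.sqrt k * Num.sqrt (Num.sqrt t ^+ 2 * pi *+ 2).
    rewrite -sqrtrM ?(ltW k0)// sqr_sqrtr ?ltW//; congr Num.sqrt.
    by rewrite /t; field; rewrite gt_eqF.
  rewrite invfM -!mulrA; congr (_ * _); rewrite [RHS]mulrCA; congr (_ * _).
  rewrite -!expRD; congr expR; rewrite sqr_sqrtr ?ltW// /t /k.
  by field; rewrite !gt_eqF.
rewrite ge0_integralZl//.
- by rewrite integral_normal_pdf mule1.
- by apply/measurable_EFinP; exact: measurable_normal_pdf.
- by move=> x _; rewrite lee_fin normal_pdf_ge0.
Qed.

End GaussianIntegral.

(** * Orthogonal projections in coordinates *)

Section Orthonormal.
Variables (R : realType) (n : nat).
Implicit Types (u v x y z : 'cV[R]_n) (S : {vspace 'cV[R]_n}).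
Implicit Types (es : seq 'cV[R]_n).

(** Stated recursively so that a vector orthogonal to the whole list stays
    orthogonal to the tail after a move along the head. *)
Fixpoint orthonormal_seq es : Prop :=
  if es is e :: es' then
    [/\ dotcv e e = 1, forall e', e' \in es' -> dotcv e e' = 0 &
      orthonormal_seq es']
  else True.

Lemma dotcvBl u v x : dotcv (u - v) x = dotcv u x - dotcv v x.
Proof. by rewrite linearBl. Qed.

Lemma dotcvBr u v x : dotcv x (u - v) = dotcv x u - dotcv x v.
Proof. by rewrite linearBr. Qed.

Lemma dotcv_addl u v x : dotcv (u + v) x = dotcv u x + dotcv v x.
Proof. by rewrite linearDl. Qed.

Lemma dotcvZl a u x : dotcv (a *: u) x = a * dotcv u x.
Proof. by rewrite linearZl. Qed.

Lemma dotcvZr a u x : dotcv x (a *: u) = a * dotcv x u.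
Proof. by rewrite linearZr. Qed.

Lemma dotcv0r x : dotcv x 0 = 0.
Proof. by rewrite linear0r. Qed.

Lemma dotcv_ge0 u : 0 <= dotcv u u.
Proof. by apply: sumr_ge0 => i _; rewrite -expr2 sqr_ge0. Qed.

Lemma sqr_enorm u : enorm u ^+ 2 = dotcv u u.
Proof. by rewrite sqr_sqrtr// dotcv_ge0. Qed.

Definition along es x := \sum_(e <- es) dotcv x e *: e.

Lemma along_mem es x : along es x \in <<es>>%VS.
Proof.
by rewrite /along big_seq memv_suml// => e ees; rewrite memvZ// memv_span.
Qed.

Lemma orthogonal_span es z : (forall e, e \in es -> dotcv z e = 0) ->
  forall y, y \in <<es>>%VS -> dotcv z y = 0.
Proof.
elim: es => [|e es IHes] ze y.
  by rewrite span_nil memv0 => /eqP ->; rewrite linear0r.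
rewrite span_cons => /memv_addP[_ /vlineP[k ->] [y' y'es ->]].
rewrite linearDr /= dotcvZr ze ?mem_head// mulr0 add0r IHes// => e' e'es.
by rewrite ze// inE e'es orbT.
Qed.

Lemma dotcv_along es x e : orthonormal_seq es -> e \in es ->
  dotcv (along es x) e = dotcv x e.
Proof.
elim: es => // e0 es IHes /= [e0e0 e0es oes]; rewrite inE /along big_cons.
rewrite dotcv_addl dotcvZl => /predU1P[->|ees].
  rewrite e0e0 mulr1 [X in _ + X](_ : _ = 0) ?addr0// dotcvC.
  by apply: (orthogonal_span e0es); exact: along_mem.
by rewrite e0es// mulr0 add0r -/(along es x) IHes.
Qed.

Lemma gram_schmidt X : free X -> exists es,
  [/\ orthonormal_seq es, size es = size X & <<es>>%VS = <<X>>%VS].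
Proof.
elim: X => [|v X IHX]; first by exists [::].
rewrite free_cons => /andP[vX /IHX[es [oes ses spes]]].
pose w := v - along es v.
have w0 : w != 0.
  apply: contra vX; rewrite subr_eq0 => /eqP ->.
  by rewrite -spes along_mem.
have ww := dotcv_gt0 w0.
have q0 : Num.sqrt (dotcv w w) != 0 by rewrite gt_eqF// sqrtr_gt0.
pose e := (Num.sqrt (dotcv w w))^-1 *: w.
exists (e :: es); split; [split => //| by rewrite /= ses |].
- rewrite /e dotcvZl dotcvZr mulrA -invfM -expr2 sqr_sqrtr ?ltW//.
  by rewrite mulVf// gt_eqF.
- by move=> e' e'es; rewrite dotcvZl [X in _ * X]dotcvBl dotcv_along// subrr mulr0.
rewrite !span_cons -spes; apply/eqP; rewrite eqEsubv !subv_add !addvSr !andbT.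
apply/andP; split.
  rewrite -memvE /e memvZ// memvB//.
    by rewrite (subvP (addvSl _ _))// memv_line.
  by rewrite (subvP (addvSr _ _))// along_mem.
have -> : v = Num.sqrt (dotcv w w) *: e + along es v.
  by rewrite /e scalerA mulfV// scale1r subrK.
rewrite -memvE memvD//.
  by rewrite (subvP (addvSl _ _))// memvZ// memv_line.
by rewrite (subvP (addvSr _ _))// along_mem.
Qed.

Lemma orthproj_unique S x y : y \in S ->
  (forall z, z \in S -> dotcv (x - y) z = 0) -> orthproj S x = y.
Proof.
move=> yS xy; apply/eqP; rewrite -subr_eq0; apply/negPn/negP => /dotcv_gt0.
have dS : orthproj S x - y \in S by rewrite memvB// orthproj_mem.
rewrite {1}(_ : orthproj S x - y = (x - y) - (x - orthproj S x)).
  by rewrite dotcvBl xy// orthproj_orth// subrr ltxx.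
by rewrite opprB [RHS]addrC addrA subrK.
Qed.

Lemma sqr_enorm_orthproj S x :
  enorm (orthproj S x) ^+ 2 = dotcv x (orthproj S x).
Proof.
apply/esym/eqP; rewrite sqr_enorm -subr_eq0 -dotcvBl.
by rewrite orthproj_orth// orthproj_mem.
Qed.

Lemma orthproj_basis S : exists es, [/\ orthonormal_seq es, size es = \dim S &
  forall x, enorm (orthproj S x) ^+ 2 = \sum_(e <- es) dotcv x e ^+ 2].
Proof.
have [es [oes ses spes]] := gram_schmidt (basis_free (vbasisP S)).
rewrite (span_basis (vbasisP S)) in spes.
exists es; split; [by []|by rewrite ses size_tuple|move=> x].
rewrite sqr_enorm_orthproj (_ : orthproj S x = along es x).
  rewrite /along linear_sumr; apply: eq_bigr => e _.
  by rewrite /= dotcvZr expr2.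
apply: orthproj_unique; first by rewrite -spes along_mem.
rewrite -spes => z; apply: orthogonal_span => e ees.
by rewrite dotcvBl dotcv_along// subrr.
Qed.

Definition orthocompl S : {vspace 'cV[R]_n} :=
  orthov (@dotcv R n : {symmetric 'cV[R]_n}) S.

Lemma dim_orthocompl S : (\dim S + \dim (orthocompl S) = n)%N.
Proof.
rewrite -dimv_disjoint_sum ?capv_orth// addv_orth dimvf dim_matrix.
by rewrite mulr1.
Qed.

Lemma orthproj_compl S x : orthproj (orthocompl S) x = x - orthproj S x.
Proof.
apply: orthproj_unique.
  by apply/mem_orthovP => y yS; apply: orthproj_orth.
move=> z /mem_orthovP zS; rewrite opprB addrC subrK dotcvC.
exact/zS/orthproj_mem.
Qed.

Lemma pythagoras S x : enorm x ^+ 2 =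
  enorm (orthproj S x) ^+ 2 + enorm (orthproj (orthocompl S) x) ^+ 2.
Proof.
rewrite !sqr_enorm_orthproj orthproj_compl sqr_enorm dotcvBr; ring.
Qed.

End Orthonormal.

(** * Exponential moments of a Gaussian vector *)

Definition noise_vector d (T : measurableType d) (R : realType)
    (P : probability T R) (n : nat) (eps : 'I_n -> {RV P >-> R}) (w : T) :
  'cV[R]_n := \col_i eps i w.

Section GaussianVector.
Context d (T : measurableType d) (R : realType) (P : probability T R).
Variables (n : nat) (sigma : R) (eps : 'I_n -> {RV P >-> R}).
Hypotheses (sigma_gt0 : 0 < sigma) (eps_gaussian : iid_gaussian sigma eps).

Local Notation noise := (noise_vector eps).

Let measurable_noise i : measurable_fun setT (fun w => noise w i 0).
Proof.
have -> : (fun w => noise w i 0) = eps i by apply/funext => w; rewrite mxE.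
exact: measurable_funPT.
Qed.

Lemma measurable_dot_noise u : measurable_fun setT (fun w => dotcv (noise w) u).
Proof. by apply: measurable_sum => i; exact: measurable_funM. Qed.

Lemma measurable_sqr_noise :
  measurable_fun setT (fun w => dotcv (noise w) (noise w)).
Proof. by apply: measurable_sum => i; exact: measurable_funM. Qed.

Variable a : R.
Hypothesis a_gt : 0 < 1 + 2 * a * sigma ^+ 2.
Local Notation k := (1 + 2 * a * sigma ^+ 2).
Local Notation tau := (sigma ^+ 2 / k).

Lemma gaussian_exp_quadratic u :
  (\int[P]_w (expR (dotcv (noise w) u - a * dotcv (noise w) (noise w)))%:E =
  ((Num.sqrt k)^-1 ^+ n * expR (tau * dotcv u u / 2))%:E)%E.
Proof.
have [indep law] := eps_gaussian.
pose f i y := expR (u i 0 * y - a * y ^+ 2).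
pose c i := (Num.sqrt k)^-1 * expR (tau * u i 0 ^+ 2 / 2).
have mf i : measurable_fun setT (f i).
  apply: measurableT_comp => //.
  by apply: measurable_funB; apply: measurable_funM.
have f0 i y : 0 <= f i y by apply: expR_ge0.
have fc i : (\int[P]_w (f i (eps i w))%:E = (c i)%:E)%E.
  have lawE (B : set R) : measurable B ->
      (\int[P]_w (cst 1 w * \1_B (eps i w))%:E = normal_prob 0 sigma B)%E.
    move=> mB; rewrite -(law i)//.
    under eq_integral do rewrite mul1r -[\1_ _ _]/(\1_(eps i @^-1` B) _).
    rewrite integral_indic ?setIT//.
    by rewrite -[X in measurable X]setTI; apply: measurable_funPT.
  have c1 (w : T) : 0 <= cst 1 w :> R by [].
  have mc1 : measurable_fun setT (cst 1 : T -> R) by [].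
  have := ge0_integral_weighted_pushforward
    (nu := normal_prob 0 sigma) (phi := eps i) (measurable_funPT (eps i))
    mc1 c1 lawE (mf i) (f0 i).
  under eq_integral do rewrite mul1r.
  move=> ->.
  exact: normal_exp_quadratic.
have -> : (fun w => (expR (dotcv (noise w) u - a * dotcv (noise w) (noise w)))%:E) =
    (fun w => (\prod_i f i (eps i w))%:E).
  apply/funext => w; congr EFin; rewrite /f -expR_sum; congr expR.
  rewrite /dotcv mulr_sumr -sumrB; apply: eq_bigr => i _.
  by rewrite !mxE expr2 mulrC.
rewrite (expectation_prod_indep indep mf f0 fc) /c big_split/=.
rewrite prodr_const card_ord -expR_sum; congr (_ * expR _)%:E.
rewrite /dotcv mulr_sumr mulr_suml; apply: eq_bigr => i _.
by rewrite expr2.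
Qed.

Variable lambda : R.
Hypotheses (lambda_ge0 : 0 <= lambda) (lambda_lt : 0 < 1 - 2 * lambda * tau).

(** Joint moment generating function of a linear form, of the squared norm, and
    of the squared norm of the projection on the span of es. Each square is
    linearized, exp (lambda y^2) being the average of exp (r t y) over a standard
    normal t, with r^2 = 2 lambda. After exchanging the integrals the vector e
    only contributes to the linear form, and orthogonality makes the remaining
    integral over t separate. No rotation of the Gaussian law is involved. *)
Lemma gaussian_exp_quadratic_along es u : orthonormal_seq es ->
  (forall e, e \in es -> dotcv u e = 0) ->
  (\int[P]_w (expR (dotcv (noise w) u - a * dotcv (noise w) (noise w)
     + lambda * \sum_(e <- es) dotcv (noise w) e ^+ 2))%:E =
  ((Num.sqrt k)^-1 ^+ n * (Num.sqrt (1 - 2 * lambda * tau))^-1 ^+ size es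
    * expR (tau * dotcv u u / 2))%:E)%E.
Proof.
elim: es u => [|e es IHes] u.
  move=> _ _; rewrite expr0 mulr1 -gaussian_exp_quadratic.
  by apply: eq_integral => w _; rewrite big_nil mulr0 addr0.
move=> /= [ee ees oes] ue.
pose A w := dotcv (noise w) u - a * dotcv (noise w) (noise w)
  + lambda * \sum_(e' <- es) dotcv (noise w) e' ^+ 2.
pose r := Num.sqrt (2 * lambda).
have r2 : r ^+ 2 = 2 * lambda by rewrite sqr_sqrtr// mulr_ge0.
pose g (z : T * R) := (expR (A z.1 + r * dotcv (noise z.1) e * z.2))%:E.
have mA : measurable_fun setT A.
  apply: measurable_funD.
    apply: measurable_funB; first exact: measurable_dot_noise.
    by apply: measurable_funM => //; exact: measurable_sqr_noise.
  apply: measurable_funM => //; apply: measurable_sum => e'.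
  by apply: measurable_funX; exact: measurable_dot_noise.
have mg : measurable_fun setT g.
  apply/measurable_EFinP; apply: measurableT_comp => //.
  apply: measurable_funD; first exact: measurableT_comp.
  apply: measurable_funM => //; apply: measurable_funM => //.
  by apply: (measurableT_comp (measurable_dot_noise e)).
have g0 z : (0 <= g z)%E by rewrite lee_fin expR_ge0.
transitivity (\int[P]_w \int[normal_prob 0 1]_t g (w, t))%E.
  apply: eq_integral => w _; rewrite /g /=.
  have := @normal_exp_quadratic R 1 0 (r * dotcv (noise w) e) ltr01.
  have k1 : 1 + 2 * 0 * 1 ^+ 2 = 1 :> R by ring.
  rewrite k1 expr1n divr1 sqrtr1 invr1 !mul1r => /(_ ltr01).
  rewrite exprMn r2 => norm1.
  have -> : (fun t => (expR (A w + r * dotcv (noise w) e * t))%:E) =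
      (fun t => ((expR (A w))%:E *
        (expR (r * dotcv (noise w) e * t - 0 * t ^+ 2))%:E)%E).
    by apply/funext => t; rewrite -EFinM -expRD mul0r subr0.
  rewrite ge0_integralZl//; last first.
    apply/measurable_EFinP; apply: measurableT_comp => //.
    by apply: measurable_funB => //; apply: measurable_funM.
  rewrite norm1 -EFinM -expRD big_cons /A; congr (expR _)%:E; by field.
transitivity (\int[normal_prob 0 1]_t \int[P]_w g (w, t))%E.
  exact: (@fubini_tonelli _ _ _ _ R P (normal_prob 0 1) g mg g0).
pose C := (Num.sqrt k)^-1 ^+ n * (Num.sqrt (1 - 2 * lambda * tau))^-1 ^+ size es.
transitivity (\int[normal_prob 0 1]_t
   ((C * expR (tau * dotcv u u / 2))%:E *
    (expR (0 * t - (- lambda * tau) * t ^+ 2))%:E))%E.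
  apply: eq_integral => t _; rewrite /g /=.
  transitivity (\int[P]_w (expR (dotcv (noise w) (u + (r * t) *: e)
      - a * dotcv (noise w) (noise w)
      + lambda * \sum_(e' <- es) dotcv (noise w) e' ^+ 2))%:E)%E.
    apply: eq_integral => w _; congr (expR _)%:E.
    rewrite /A [dotcv (noise w) (u + _)]linearDr /= dotcvZr; ring.
  rewrite IHes//; last first.
    move=> e' e'es; rewrite dotcv_addl dotcvZl ees// mulr0 addr0 ue//.
    by rewrite inE e'es orbT.
  rewrite -/C -EFinM -(mulrA C) -expRD; congr (_ * expR _)%:E.
  have ue0 : dotcv u e = 0 by rewrite ue// mem_head.
  have eu0 : dotcv e u = 0 by rewrite dotcvC.
  rewrite dotcv_addl !(linearDr _ _ _) /= !dotcvZl !dotcvZr ee ue0 eu0.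
  have -> : (r * t) * (r * t * 1) = r ^+ 2 * t ^+ 2 by ring.
  by rewrite r2; move: (sigma ^+ 2 / _) => z; field.
rewrite ge0_integralZl//; last 2 first.
- apply/measurable_EFinP; apply: measurableT_comp => //.
  by apply: measurable_funB; apply: measurable_funM.
- by rewrite lee_fin !mulr_ge0 ?exprn_ge0 ?invr_ge0 ?sqrtr_ge0 ?expR_ge0.
have k1 : 1 + 2 * (- lambda * tau) * 1 ^+ 2 = 1 - 2 * lambda * tau by ring.
rewrite normal_exp_quadratic ?k1//.
rewrite expr0n/= mulr0 mul0r expR0 mulr1 -EFinM /C.
rewrite (exprSr _ (size es)); congr (_%:E).
by rewrite mulrAC; congr (_ * _); exact/esym/mulrA.
Qed.

End GaussianVector.

(** * Tails of linear forms and of projections *)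

Section TailBounds.
Context d (T : measurableType d) (R : realType) (P : probability T R).
Variables (n : nat) (sigma : R) (eps : 'I_n -> {RV P >-> R}).
Hypotheses (sigma_gt0 : 0 < sigma) (eps_gaussian : iid_gaussian sigma eps).

Local Notation noise := (noise_vector eps).

(** On the event, exp Z is at least exp t. *)
Lemma exp_markov (Z : T -> R) (C t x : R) : measurable_fun setT Z ->
  (\int[P]_w (expR (Z w))%:E = C%:E)%E -> C <= expR (t - x) ->
  (P [set w | t < Z w]%R <= (expR (- x))%:E)%E.
Proof.
move=> mZ EZ Cle; set A := [set w | _].
have mA : measurable A.
  have -> : A = [set: T] `&` Z @^-1` `]t, +oo[%classic.
    by rewrite setTI; apply/seteqP; split => w /=; rewrite /A in_itv/= andbT.
  exact: mZ.
have : (\int[P]_w (expR t * \1_A w)%:E <= C%:E)%E.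
  rewrite -EZ; apply: ge0_le_integral => //.
  - by apply/measurable_EFinP; apply: measurable_funM.
  - by apply/measurable_EFinP; exact: measurableT_comp.
  - move=> w _; rewrite lee_fin indicE; have [wA|_] := boolP (w \in A).
      by rewrite mulr1 ler_expR ltW//; move: wA; rewrite inE.
    by rewrite mulr0 expR_ge0.
have -> : (\int[P]_w (expR t * \1_A w)%:E = (expR t)%:E * P A)%E.
  under eq_integral do rewrite EFinM.
  rewrite ge0_integralZl//; last exact/measurable_EFinP.
  by rewrite integral_indic// setIT.
rewrite -(fineK (fin_num_measure P A mA)) -EFinM !lee_fin => h.
rewrite -(ler_pM2l (expR_gt0 t)) -expRD; exact: le_trans h Cle.
Qed.

Variable x : R.
Hypothesis x_gt0 : 0 < x.

Lemma linear_tail u :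
  (P [set w | sigma * Num.sqrt (2 * x * dotcv u u) < dotcv (noise w) u]%R <=
   (expR (- x))%:E)%E.
Proof.
have [->|u0] := eqVneq u 0.
  rewrite (_ : [set w | _] = set0) ?measure0 ?lee_fin ?expR_ge0//.
  by apply/seteqP; split=> w //=; rewrite !dotcv0r mulr0 sqrtr0 mulr0 ltxx.
have U0 := dotcv_gt0 u0.
set U := dotcv u u in U0 *; have q0 : 0 < Num.sqrt U by rewrite sqrtr_gt0.
have x20 : 0 < 2 * x by rewrite mulr_gt0.
pose l := Num.sqrt (2 * x) / (sigma * Num.sqrt U).
have l0 : 0 < l by rewrite divr_gt0 ?mulr_gt0// sqrtr_gt0.
have lq : l * (sigma * Num.sqrt U) = Num.sqrt (2 * x).
  by rewrite divfK// gt_eqF// mulr_gt0.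
have k1 : 1 + 2 * 0 * sigma ^+ 2 = 1 :> R by ring.
have := @gaussian_exp_quadratic _ _ _ _ _ _ _ sigma_gt0 eps_gaussian 0.
rewrite k1 => /(_ ltr01 (l *: u)).
rewrite divr1 sqrtr1 invr1 expr1n mul1r dotcvZl !dotcvZr -/U.
have -> : sigma ^+ 2 * (l * (l * U)) / 2 = x.
  have -> : sigma ^+ 2 * (l * (l * U)) = (l * (sigma * Num.sqrt U)) ^+ 2.
    by rewrite -{1}(sqr_sqrtr (ltW U0)); ring.
  by rewrite lq sqr_sqrtr ?(ltW x20)// mulrC mulKf.
under eq_integral do rewrite mul0r subr0.
move=> EZ; have mZ := measurable_dot_noise eps (l *: u).
have C_le : expR x <= expR (2 * x - x) by rewrite ler_expR; lra.
have := exp_markov mZ EZ C_le.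
have twox : l * (sigma * Num.sqrt (2 * x * U)) = 2 * x.
  rewrite sqrtrM ?(ltW x20)// [sigma * _]mulrCA (mulrCA l) lq -expr2.
  by rewrite sqr_sqrtr// ltW.
have -> : [set w | 2 * x < dotcv (noise w) (l *: u)]%R =
    [set w | sigma * Num.sqrt (2 * x * U) < dotcv (noise w) u]%R.
  apply/seteqP; split => w /=; rewrite dotcvZr;
    by rewrite -(ltr_pM2l l0 (sigma * _)) twox.
by [].
Qed.

(** The squared norm of the projection over sigma^2 is a chi-square variable with
    D degrees of freedom; this is its upper Chernoff bound. In units of sigma^2
    the optimal parameter is sqrt x / (sqrt D + 2 sqrt x), for which the
    exponent is exactly - x. *)
Lemma sqr_proj_upper_tail (S : {vspace 'cV[R]_n}) (D := (\dim S)%:R : R) :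
  (P [set w | sigma ^+ 2 * (D + 2 * Num.sqrt (D * x) + 2 * x) <
     enorm (orthproj S (noise w)) ^+ 2]%R <= (expR (- x))%:E)%E.
Proof.
have [es [oes ses projE]] := orthproj_basis S.
have s2 : 0 < sigma ^+ 2 by rewrite exprn_gt0.
have [D0|D0] := posnP (\dim S).
  rewrite (_ : [set w | _] = set0) ?measure0 ?lee_fin ?expR_ge0//.
  apply/seteqP; split=> w //=; rewrite projE.
  move: ses; rewrite D0 => /size0nil ->; rewrite big_nil /D D0 mul0r sqrtr0.
  by rewrite mulr0 addr0 add0r ltNge !mulr_ge0// ltW.
have {}D0 : 0 < D by rewrite ltr0n.
set p := Num.sqrt D; set q := Num.sqrt x.
have p0 : 0 < p by rewrite sqrtr_gt0.
have q0 : 0 < q by rewrite sqrtr_gt0.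
have p2 : D = p ^+ 2 by rewrite sqr_sqrtr// ltW.
have q2 : x = q ^+ 2 by rewrite sqr_sqrtr// ltW.
have pq : Num.sqrt (D * x) = p * q by rewrite sqrtrM// ltW.
have pq0 : 0 < p + 2 * q by lra.
pose l := q / (p + 2 * q).
have l0 : 0 < l by rewrite divr_gt0.
have l1 : 1 - 2 * l = p / (p + 2 * q) by rewrite /l; field; rewrite gt_eqF.
have l10 : 0 < 1 - 2 * l by rewrite l1 divr_gt0.
pose lambda := l / sigma ^+ 2.
have la0 : 0 <= lambda by rewrite divr_ge0// ltW.
have k1 : 1 + 2 * 0 * sigma ^+ 2 = 1 :> R by ring.
have laE : 1 - 2 * lambda * (sigma ^+ 2 / 1) = 1 - 2 * l.
  by rewrite /lambda; field; rewrite gt_eqF.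
have := @gaussian_exp_quadratic_along _ _ _ _ _ _ _ sigma_gt0 eps_gaussian 0.
rewrite k1 => /(_ ltr01 lambda la0); rewrite laE => /(_ l10 es 0 oes).
have oe0 e : e \in es -> dotcv 0 e = 0 by rewrite dotcvC dotcv0r.
move=> /(_ oe0); rewrite sqrtr1 invr1 expr1n mul1r dotcv0r mulr0 mul0r expR0 mulr1.
under eq_integral do rewrite dotcv0r mul0r subr0 add0r -projE.
rewrite ses => EZ.
have mZ : measurable_fun setT
    (fun w => lambda * enorm (orthproj S (noise w)) ^+ 2).
  apply: measurable_funM => //; under eq_fun do rewrite projE.
  apply: measurable_sum => e; apply: measurable_funX.
  exact: measurable_dot_noise.
have C_le : (Num.sqrt (1 - 2 * l))^-1 ^+ \dim S <=
    expR (l * (D + 2 * Num.sqrt (D * x) + 2 * x) - x).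
  have -> : l * (D + 2 * Num.sqrt (D * x) + 2 * x) - x =
      (l + l ^+ 2 / (1 - 2 * l)) * (\dim S)%:R.
    rewrite -/D l1 pq {1 2}q2 p2 /l; field.
    by rewrite !gt_eqF.
  rewrite expRM_natr lerXn2r ?nnegrE ?invr_ge0 ?sqrtr_ge0 ?expR_ge0//.
  have y0 : 0 <= expR (l + l ^+ 2 / (1 - 2 * l)) by exact: expR_ge0.
  rewrite -sqrtrV ?(ltW l10)// -(ger0_norm y0) -sqrtr_sqr ler_sqrt ?sqr_ge0//.
  rewrite -expRM_natl; have l2 : 0 <= 2 * l < 1 by lra.
  apply: le_trans (inv_le_expR l2) _; rewrite ler_expR le_eqVlt.
  apply/orP; left; apply/eqP.
  by field; rewrite gt_eqF.
have := exp_markov mZ EZ C_le.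
have -> : [set w | l * (D + 2 * Num.sqrt (D * x) + 2 * x) <
       lambda * enorm (orthproj S (noise w)) ^+ 2]%R =
   [set w | sigma ^+ 2 * (D + 2 * Num.sqrt (D * x) + 2 * x) <
     enorm (orthproj S (noise w)) ^+ 2]%R.
  apply/seteqP; split => w /=;
    rewrite /lambda [l / _ * _]mulrAC ltr_pdivlMr// -(mulrA l);
    by rewrite (ltr_pM2l l0) (mulrC _ (sigma ^+ 2)).
by [].
Qed.

(** The formula for the moment generating function allows only positive
    coefficients in front of projections. By Pythagoras, minus the squared norm
    of the projection on S is minus the full squared norm, which factors over
    the coordinates, plus the squared norm of the projection on the orthogonal
    complement. The optimal parameter is sqrt (x / D) in units of sigma^2. *)
Lemma sqr_proj_lower_tail (S : {vspace 'cV[R]_n}) (D := (\dim S)%:R : R) :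
  (P [set w | enorm (orthproj S (noise w)) ^+ 2 <
     sigma ^+ 2 * (D - 2 * Num.sqrt (D * x))]%R <= (expR (- x))%:E)%E.
Proof.
have s2 : 0 < sigma ^+ 2 by rewrite exprn_gt0.
have [D0|D0] := posnP (\dim S).
  rewrite (_ : [set w | _] = set0) ?measure0 ?lee_fin ?expR_ge0//.
  apply/seteqP; split=> w //=; rewrite /D D0 mul0r sqrtr0 mulr0 subr0 mulr0.
  by rewrite ltNge sqr_ge0.
have {}D0 : 0 < D by rewrite ltr0n.
have [es [oes ses projE]] := orthproj_basis (orthocompl S).
set p := Num.sqrt D; set q := Num.sqrt x.
have p0 : 0 < p by rewrite sqrtr_gt0.
have q0 : 0 < q by rewrite sqrtr_gt0.
have p2 : D = p ^+ 2 by rewrite sqr_sqrtr// ltW.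
have q2 : x = q ^+ 2 by rewrite sqr_sqrtr// ltW.
have pq : Num.sqrt (D * x) = p * q by rewrite sqrtrM// ltW.
pose l := q / p.
have l0 : 0 < l by rewrite divr_gt0.
pose lambda := l / sigma ^+ 2.
have la0 : 0 <= lambda by rewrite divr_ge0// ltW.
have kE : 1 + 2 * lambda * sigma ^+ 2 = 1 + 2 * l.
  by rewrite /lambda; field; rewrite gt_eqF.
have k0 : 0 < 1 + 2 * l by lra.
have laE : 1 - 2 * lambda * (sigma ^+ 2 / (1 + 2 * l)) = (1 + 2 * l)^-1.
  by rewrite /lambda; field; rewrite !gt_eqF.
have := @gaussian_exp_quadratic_along _ _ _ _ _ _ _ sigma_gt0 eps_gaussian lambda.
rewrite kE => /(_ k0 lambda la0); rewrite laE invr_gt0 => /(_ k0 es 0 oes).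
have oe0 e : e \in es -> dotcv 0 e = 0 by rewrite dotcvC dotcv0r.
move=> /(_ oe0); rewrite dotcv0r mulr0 mul0r expR0 mulr1.
have ZE w : dotcv (noise w) 0 - lambda * dotcv (noise w) (noise w) +
    lambda * \sum_(e <- es) dotcv (noise w) e ^+ 2 =
    - (lambda * enorm (orthproj S (noise w)) ^+ 2).
  rewrite dotcv0r -projE -sqr_enorm (pythagoras S (noise w)); ring.
under eq_integral do rewrite ZE.
move=> EZ.
have mZ : measurable_fun setT
    (fun w => - (lambda * enorm (orthproj S (noise w)) ^+ 2)).
  under eq_fun do rewrite -ZE.
  apply: measurable_funD.
    apply: measurable_funB; first exact: measurable_dot_noise.
    by apply: measurable_funM => //; exact: measurable_sqr_noise.
  apply: measurable_funM => //; apply: measurable_sum => e.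
  by apply: measurable_funX; exact: measurable_dot_noise.
have C_le : (Num.sqrt (1 + 2 * l))^-1 ^+ n *
    (Num.sqrt (1 + 2 * l)^-1)^-1 ^+ size es <=
    expR (- (l * (D - 2 * Num.sqrt (D * x))) - x).
  have r0 : 0 < Num.sqrt (1 + 2 * l) by rewrite sqrtr_gt0.
  rewrite sqrtrV ?(ltW k0)// invrK ses -[X in _ ^+ X * _](dim_orthocompl S).
  rewrite exprD -mulrA -exprMn mulVf ?gt_eqF// expr1n mulr1.
  have -> : - (l * (D - 2 * Num.sqrt (D * x))) - x =
      (- (l - l ^+ 2)) * (\dim S)%:R.
    rewrite -/D pq {1}q2 p2 /l; field.
    by rewrite gt_eqF.
  rewrite expRM_natr lerXn2r ?nnegrE ?invr_ge0 ?sqrtr_ge0 ?expR_ge0//.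
  rewrite expRN lef_pV2 ?posrE ?expR_gt0//.
  have y0 : 0 <= expR (l - l ^+ 2) by exact: expR_ge0.
  rewrite -(ger0_norm y0) -sqrtr_sqr ler_sqrt ?(ltW k0)//.
  rewrite -expRM_natl; have l2 : 0 <= 2 * l by lra.
  apply: le_trans (expR_le1D l2); rewrite ler_expR le_eqVlt.
  apply/orP; left; apply/eqP.
  by field.
have := exp_markov mZ EZ C_le.
have -> : [set w | - (l * (D - 2 * Num.sqrt (D * x))) <
       - (lambda * enorm (orthproj S (noise w)) ^+ 2)]%R =
   [set w | enorm (orthproj S (noise w)) ^+ 2 <
     sigma ^+ 2 * (D - 2 * Num.sqrt (D * x))]%R.
  apply/seteqP; split => w /=;
    rewrite ltrN2 /lambda [l / _ * _]mulrAC ltr_pdivrMr// -(mulrA l);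
    by rewrite (ltr_pM2l l0) (mulrC _ (sigma ^+ 2)).
by [].
Qed.

End TailBounds.

(** * Comparison of criterion and risk *)

Section Deterministic.
Variable R : realType.
Implicit Types (a b c x t v g D theta u alpha beta : R).

Lemma young_sqrt a b theta : 0 <= a -> 0 <= b -> 0 < theta ->
  2 * Num.sqrt (a * b) <= theta * a + b / theta.
Proof.
move=> a0 b0 t0.
have -> : a * b = (theta * a) * (b / theta) by field; rewrite gt_eqF.
have p0 : 0 <= theta * a by rewrite mulr_ge0// ltW.
have q0 : 0 <= b / theta by rewrite divr_ge0// ltW.
rewrite sqrtrM// -{2}(sqr_sqrtr p0) -{2}(sqr_sqrtr q0).
have := sqr_ge0 (Num.sqrt (theta * a) - Num.sqrt (b / theta)); nra.
Qed.

(** Everything that the noise has to satisfy in one model, in units of sigma^2: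
    b is the squared bias, v the squared norm of the projected noise, g the
    scalar product of the noise with the bias vector, D the dimension. In these
    units the risk of the model is b + v and its criterion, up to a term that
    does not depend on the model, is b + 2 g - v + u D with u = C / sigma^2. *)
Record concentrated x b v g D : Prop := Concentrated {
  conc_x_ge0 : 0 <= x;
  conc_b_ge0 : 0 <= b;
  conc_v_ge0 : 0 <= v;
  conc_D_ge0 : 0 <= D;
  conc_g : `|g| <= Num.sqrt (2 * x * b);
  conc_lower : D - 2 * Num.sqrt (D * x) <= v;
  conc_upper : v <= D + 2 * Num.sqrt (D * x) + 2 * x }.

Lemma cross_term_le x b v g D theta : concentrated x b v g D -> 0 < theta ->
  2 * `|g| <= theta * b + 2 * x / theta.
Proof.
case=> x0 b0 _ _ gb _ _ t0.
apply: le_trans (young_sqrt b0 (mulr_ge0 (ler0n _ 2) x0) t0).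
by rewrite ler_pM2l// mulrC.
Qed.

(** The criterion b + 2 g - v + u D differs from the risk b + v because v is
    counted negatively and D stands for v. But v and D control each other up
    to a factor 1 +- t and a multiple of x / t, so u D - v is essentially
    (u - 1) v. The four weights t1, ..., t4 are left free: each conclusion about
    the risk is one choice of them. *)
Lemma risk_comparison x b v g D b' v' g' D' u t1 t2 t3 t4 alpha beta :
  concentrated x b v g D -> concentrated x b' v' g' D' ->
  0 < t1 -> 0 < t2 -> 0 < t3 -> 0 < t4 < 1 -> 0 <= u ->
  alpha <= 1 - t1 -> alpha <= u / (1 + t2) - 1 ->
  1 + t3 <= beta -> u / (1 - t4) - 1 <= beta ->
  b + 2 * g - v + u * D <= b' + 2 * g' - v' + u * D' ->
  alpha * (b + v) <= beta * (b' + v') +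
    (2 / t1 + 2 / t3 +
     u * ((2 + t2^-1) / (1 + t2) + (t4 * (1 - t4))^-1)) * x.
Proof.
move=> mc mc' t10 t20 t30 /andP[t40 t41] u0 a1 a2 b1 b2 opt.
have g1 := cross_term_le mc t10.
have g3 := cross_term_le mc' t30.
case: mc => x0 b0 v0 D0 _ _ up.
case: mc' => _ b'0 v'0 D'0 _ lo _.
have y2 := young_sqrt D0 x0 t20.
have y4 := young_sqrt D'0 x0 t40.
have : (v - (2 + t2^-1) * x) / (1 + t2) <= D.
  by rewrite ler_pdivrMr ?addr_gt0//; move: up y2; set s := Num.sqrt _; lra.
move=> /(ler_wpM2l u0) hD.
have : D' <= (v' + x / t4) / (1 - t4).
  by rewrite ler_pdivlMr ?subr_gt0//; move: lo y4; set s := Num.sqrt _; lra.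
move=> /(ler_wpM2l u0) hD'.
have h1 := ler_wpM2r b0 a1.
have h2 := ler_wpM2r v0 a2.
have h3 := ler_wpM2r b'0 b1.
have h4 := ler_wpM2r v'0 b2.
have gl : - `|g| <= g by rewrite lerNl -normrN ler_norm.
have gl' := ler_norm g'.
have e1 : (t4 * (1 - t4))^-1 = t4^-1 / (1 - t4) by rewrite invfM.
rewrite e1; move: h1 h2 h3 h4 hD hD' g1 g3 opt gl gl'.
move: `|g| `|g'| => z z'.
set i1 := t1^-1; set i2 := t2^-1; set i3 := t3^-1.
set i4 := t4^-1; set j2 := (1 + t2)^-1; set j4 := (1 - t4)^-1.
move=> h1 h2 h3 h4 hD hD' g1 g3 opt gl gl'.
lra.
Qed.

(** Writing x = q^2 n makes the deviation terms polynomial in q and n, so that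
    the thresholds on the penalty become comparisons of q with constants. *)
Lemma sqrt_dim_le n q D : 0 < n -> 0 <= q -> 0 <= D <= n ->
  Num.sqrt (D * (q ^+ 2 * n)) <= q * n.
Proof.
move=> n0 q0 /andP[D0 Dn].
have qn0 : 0 <= q * n by rewrite mulr_ge0// ltW.
rewrite -(ger0_norm qn0) -sqrtr_sqr ler_sqrt ?sqr_ge0//.
have -> : (q * n) ^+ 2 = q ^+ 2 * n * n by ring.
by rewrite mulrC ler_wpM2l// mulr_ge0 ?sqr_ge0// ltW.
Qed.

(** Along models, the empirical risk decreases like - D: when the penalty is
    below 1 per dimension by more than the deviations, the full space, whose
    bias vanishes, wins against any model that leaves out a tenth of the
    dimensions. *)
Lemma small_penalty_dimension n q b v g D b' v' g' u :
  0 < n -> 0 < q <= 80^-1 ->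
  concentrated (q ^+ 2 * n) b v g D ->
  concentrated (q ^+ 2 * n) b' v' g' n -> b' = 0 -> D <= n ->
  u <= 1 - 41 * q ->
  b + 2 * g - v + u * D <= b' + 2 * g' - v' + u * n ->
  9 * n / 10 <= D.
Proof.
move=> n0 /andP[q0 q1] mc mc' b'0 Dn hu opt; rewrite leNgt; apply/negP => hD.
have g1 := cross_term_le mc ltr01.
have g'0 : g' <= 0.
  have := conc_g mc'; rewrite b'0 mulr0 sqrtr0; exact: le_trans (ler_norm _).
have b0 := conc_b_ge0 mc.
have D0 := conc_D_ge0 mc.
have up := conc_upper mc.
have lo := conc_lower mc'.
have gl : - `|g| <= g by rewrite lerNl -normrN ler_norm.
have s1 : Num.sqrt (D * (q ^+ 2 * n)) <= q * n.
  by apply: sqrt_dim_le => //; [exact: ltW|exact/andP].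
have s2 : Num.sqrt (n * (q ^+ 2 * n)) <= q * n.
  by apply: sqrt_dim_le => //; [exact: ltW|rewrite lexx ltW].
have nD : 0 <= n - D by rewrite subr_ge0.
have hu' : 41 * q <= 1 - u by lra.
have k1 := ler_wpM2r nD hu'.
have qn0 : 0 < q * n by rewrite mulr_gt0.
have k2 : 4 * (q * n) + q * n * 10^-1 < 41 * q * (n - D).
  have : q * (n / 10) < q * (n - D) by rewrite ltr_pM2l//; lra.
  lra.
have k3 : q ^+ 2 * n <= 80^-1 * (q * n).
  by rewrite expr2 -mulrA ler_pM2r.
move: up lo g1; rewrite b'0 in opt.
move: s1 s2; set r1 := Num.sqrt _; set r2 := Num.sqrt _; rewrite divr1; lra.
Qed.

Lemma large_dimension_risk n q b v g D :
  0 < n -> 0 <= q <= 80^-1 ->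
  concentrated (q ^+ 2 * n) b v g D -> D <= n -> 9 * n / 10 <= D ->
  7 / 8 * n <= b + v.
Proof.
move=> n0 /andP[q0 q1] mc Dn hD.
have s1 : Num.sqrt (D * (q ^+ 2 * n)) <= q * n.
  by apply: sqrt_dim_le => //; rewrite (conc_D_ge0 mc).
have := conc_lower mc; have := conc_b_ge0 mc.
have : q * n <= 80^-1 * n by rewrite ler_pM2r.
move: s1; set r := Num.sqrt _; lra.
Qed.

(** Against the small model of dimension D', a gain of at most 2 b' plus
    deviations is available, whereas the excess penalty costs
    (u - 1) (D - D'), with D - D' > n / 20 if D > n / 10. *)
Lemma large_penalty_dimension n q b v g D b' v' g' D' u :
  0 < n -> 0 < q <= 80^-1 ->
  concentrated (q ^+ 2 * n) b v g D ->
  concentrated (q ^+ 2 * n) b' v' g' D' -> D <= n -> D' <= n / 20 ->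
  1 + 40 * b' / n + 82 * q <= u ->
  b + 2 * g - v + u * D <= b' + 2 * g' - v' + u * D' ->
  D <= n / 10.
Proof.
move=> n0 /andP[q0 q1] mc mc' Dn D'n hu opt; rewrite leNgt; apply/negP => hD.
have g1 := cross_term_le mc ltr01.
have g'1 := cross_term_le mc' ltr01.
have b0 := conc_b_ge0 mc.
have b'0 := conc_b_ge0 mc'.
have up := conc_upper mc.
have lo := conc_lower mc'.
have gl : - `|g| <= g by rewrite lerNl -normrN ler_norm.
have gl' := ler_norm g'.
have s1 : Num.sqrt (D * (q ^+ 2 * n)) <= q * n.
  by apply: sqrt_dim_le => //; [exact: ltW|rewrite (conc_D_ge0 mc)].
(* D' <= n / 16 suffices for the factor 1 / 4. *)
have s2 : Num.sqrt (D' * (q ^+ 2 * n)) <= q * n / 4.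
  have -> : q * n / 4 = (q / 4) * n by ring.
  have -> : D' * (q ^+ 2 * n) = (16 * D') * ((q / 4) ^+ 2 * n) by field.
  apply: sqrt_dim_le => //; first lra.
  by have := conc_D_ge0 mc'; lra.
have k1 : (40 * b' / n + 82 * q) * (n / 20) <= (u - 1) * (D - D').
  have : 0 <= b' / n by rewrite divr_ge0// ltW.
  by move=> ?; apply: ler_pM; lra.
have k2 : (40 * b' / n + 82 * q) * (n / 20) = 2 * b' + 41 / 10 * (q * n).
  by field; rewrite gt_eqF.
have qn0 : 0 < q * n by rewrite mulr_gt0.
have k3 : q ^+ 2 * n <= 80^-1 * (q * n).
  by rewrite expr2 -mulrA ler_pM2r.
move: up lo g1 g'1; rewrite k2 in k1.
move: s1 s2; set r1 := Num.sqrt _; set r2 := Num.sqrt _; rewrite divr1; lra.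
Qed.

(** Near u = 1 the factor of v in the criterion is only of order u - 1, hence
    the weight t2 = (u - 1) / 4, which keeps it at least 3 (u - 1) / 5. For
    u >= 2 absolute weights are enough. *)
Lemma slope_risk x b v g D b' v' g' D' u :
  concentrated x b v g D -> concentrated x b' v' g' D' -> 1 < u ->
  b + 2 * g - v + u * D <= b' + 2 * g' - v' + u * D' ->
  b + v <= slope_factor u * (b' + v' + 20 * x).
Proof.
move=> mc mc' u1 opt.
have x0 := conc_x_ge0 mc.
have R'0 : 0 <= b' + v' by rewrite addr_ge0 ?(conc_b_ge0 mc') ?(conc_v_ge0 mc').
rewrite /slope_factor !indicE; have [u2|u2] := ltP u 2.
  rewrite mem_set/= ?in_itv/= ?u1// memNset/=; last first.
    by rewrite in_itv/= andbT; lra.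
  rewrite mulr1 mulr0 addr0.
  have [e ue] : exists e, u = 1 + e by exists (u - 1); ring.
  subst u; have -> : 1 + e - 1 = e by ring.
  have e0 : 0 < e by lra.
  have e4 : 0 < 1 + e / 4 by lra.
  have := @risk_comparison x b v g D b' v' g' D' (1 + e) (2 / 5) (e / 4) 1 (1 / 2)
    (3 / 5 * e) 3 mc mc' ltac:(lra) ltac:(lra) ltac:(lra) ltac:(lra) ltac:(lra).
  have a1 : 3 / 5 * e <= 1 - 2 / 5 by lra.
  have a2 : 3 / 5 * e <= (1 + e) / (1 + e / 4) - 1.
    rewrite lerBrDr ler_pdivlMr//; nra.
  have b1 : 1 + 1 <= 3 :> R by lra.
  have b2 : (1 + e) / (1 - 1 / 2) - 1 <= 3.
    have -> : (1 - 1 / 2)^-1 = 2 :> R by field.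
    lra.
  move=> /(_ a1 a2 b1 b2 opt).
  have iE : (e / 4)^-1 = 4 / e by rewrite invf_div.
  have k1 : (2 + (e / 4)^-1) / (1 + e / 4) <= 2 + 4 / e.
    rewrite iE ler_pdivrMr// ler_peMr//; last lra.
    by rewrite addr_ge0// divr_ge0// ltW.
  have k2 : (1 + e) * ((2 + (e / 4)^-1) / (1 + e / 4) + (1 / 2 * (1 - 1 / 2))^-1) <=
      2 * (2 + 4 / e + 4).
    have p1 : 0 <= (2 + (e / 4)^-1) / (1 + e / 4).
      by apply: divr_ge0; [rewrite iE addr_ge0// divr_ge0// ltW|exact: ltW].
    have -> : (1 / 2 * (1 - 1 / 2))^-1 = 4 :> R by field.
    apply: ler_pM; lra.
  have ei1 : 1 <= e^-1 by rewrite invf_ge1//; lra.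
  move=> /le_trans - /(_ (3 * (b' + v') + 27 / e * x)) h.
  have {}h : 3 / 5 * e * (b + v) <= 3 * (b' + v') + 27 / e * x.
    apply: h; rewrite lerD2l ler_wpM2r//.
    by move: k2; set k := (1 + e) * _; lra.
  have : b + v <= 5 / e * (b' + v') + 45 / e ^+ 2 * x.
    rewrite -(ler_pM2l (_ : 0 < 3 / 5 * e)); last lra.
    apply: le_trans h _; rewrite le_eqVlt; apply/orP; left; apply/eqP.
    by field; rewrite gt_eqF.
  move/le_trans; apply.
  have ei0 : 0 <= e^-1 by rewrite invr_ge0 ltW.
  have ei2 : 1 <= e^-1 ^+ 2 by rewrite exprn_ege1.
  have ei3 : e^-1 <= e^-1 ^+ 4.
    by rewrite exprS ler_peMr// exprn_ege1.
  have ei4 : e^-1 ^+ 2 <= e^-1 ^+ 4.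
    by rewrite -[4%N]/(2 + 2)%N exprD ler_peMr// ltW// exprn_gt0// invr_gt0.
  rewrite [leRHS]mulrDr -!exprVn; apply: lerD; first by rewrite ler_wpM2r//; lra.
  by rewrite mulrA ler_wpM2r//; lra.
rewrite memNset/= ?in_itv/=; last by apply/negP; rewrite u1 -leNgt.
rewrite mem_set/= ?in_itv/= ?u2// mulr0 add0r mulr1.
have a2 : 1 / 2 <= u / (1 + 1 / 3) - 1.
  have -> : (1 + 1 / 3)^-1 = 3 / 4 :> R by field.
  lra.
have b2 : u / (1 - 1 / 2) - 1 <= 2 * u - 1.
  have -> : (1 - 1 / 2)^-1 = 2 :> R by field.
  lra.
have := @risk_comparison x b v g D b' v' g' D' u (1 / 2) (1 / 3) 1 (1 / 2)
  (1 / 2) (2 * u - 1) mc mc' ltac:(lra) ltac:(lra) ltac:(lra) ltac:(lra)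
  ltac:(lra) ltac:(lra) a2 ltac:(lra) b2 opt.
have u3 : 4 * u <= u ^+ 3.
  by rewrite exprS mulrC ler_wpM2l//; nra.
have -> : 2 / (1 / 2) + 2 / 1 + u * ((2 + (1 / 3)^-1) / (1 + 1 / 3) +
    (1 / 2 * (1 - 1 / 2))^-1) = 6 + 31 / 4 * u :> R by field.
have k1 : (2 * u - 1) * (b' + v') <= 1 / 2 * u ^+ 3 * (b' + v').
  by rewrite ler_wpM2r//; lra.
have k2 : (6 + 31 / 4 * u) * x <= 10 * u ^+ 3 * x by rewrite ler_wpM2r//; lra.
lra.
Qed.

(** At u = 2 the criterion estimates the risk without bias, up to a constant.
    With all four weights equal to eta / 20, the ratio of the two risk
    coefficients is at most 1 + 3 eta; which of them departs from 1 depends on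
    the sign of u - 2. *)
Lemma near_two_risk x b v g D b' v' g' D' u eta :
  concentrated x b v g D -> concentrated x b' v' g' D' ->
  0 < eta <= 1 / 2 -> 2 - eta <= u <= 2 + eta ->
  b + 2 * g - v + u * D <= b' + 2 * g' - v' + u * D' ->
  b + v <= (1 + 3 * eta) * (b' + v') + 880 / eta * x.
Proof.
move=> mc mc' /andP[e0 e1] /andP[ul uu] opt.
have x0 := conc_x_ge0 mc.
have R'0 : 0 <= b' + v' by rewrite addr_ge0 ?(conc_b_ge0 mc') ?(conc_v_ge0 mc').
pose t := eta / 20.
have t0 : 0 < t by rewrite /t; lra.
have t1 : t <= 1 / 40 by rewrite /t; lra.
have ti : t^-1 = 20 / eta by rewrite invf_div.
have ei : 2 <= eta^-1 by rewrite -(invrK 2) lef_pV2 ?posrE//; lra.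
have kappa : 2 / t + 2 / t + u * ((2 + t^-1) / (1 + t) + (t * (1 - t))^-1) <=
    190 / eta.
  have k1 : (2 + t^-1) / (1 + t) <= 2 + t^-1.
    rewrite ler_pdivrMr ?ler_peMr//; [|lra|lra].
    by rewrite addr_ge0// invr_ge0 ltW.
  have k2 : (t * (1 - t))^-1 <= 40 / 39 * t^-1.
    rewrite invfM mulrC ler_pM2r ?invr_gt0//.
    by rewrite -(invrK (40 / 39)) lef_pV2 ?posrE; lra.
  have p1 : 0 <= (2 + t^-1) / (1 + t).
    by rewrite divr_ge0 ?addr_ge0 ?invr_ge0// ltW.
  have p2 : 0 <= (t * (1 - t))^-1.
    by rewrite invr_ge0 mulr_ge0 ?subr_ge0 ?ltW//; lra.
  have : u * ((2 + t^-1) / (1 + t) + (t * (1 - t))^-1) <=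
      5 / 2 * (2 + t^-1 + 40 / 39 * t^-1).
    by apply: ler_pM; [lra|lra|lra|lra].
  rewrite ti; set k := u * _; lra.
suff [alpha [beta [a0 [a1 [a2 [b1 [b2 ab]]]]]]] : exists alpha, exists beta,
    9 / 20 <= alpha /\ alpha <= 1 - t /\ alpha <= u / (1 + t) - 1 /\
    1 + t <= beta /\ u / (1 - t) - 1 <= beta /\ beta <= (1 + 3 * eta) * alpha.
  have := risk_comparison mc mc' t0 t0 t0 (_ : 0 < t < 1) _ a1 a2 b1 b2 opt.
  move=> /(_ ltac:(lra) ltac:(lra)) h.
  have al0 : 0 < alpha by lra.
  rewrite -(ler_pM2l al0); apply: le_trans h _.
  rewrite [leRHS]mulrDr; apply: lerD; first by rewrite mulrA ler_wpM2r// mulrC.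
  rewrite mulrA ler_wpM2r//; apply: le_trans kappa _.
  (* 9 / 20 * 880 = 396 exceeds 190. *)
  have -> : 880 = 44 * 20 :> R by rewrite -natrM.
  have : 9 / 20 * (44 * 20 / eta) <= alpha * (44 * 20 / eta).
    by rewrite ler_wpM2r// !mulr_ge0// invr_ge0 ltW.
  move: ei; set w := eta^-1; lra.
have p1 : 0 < 1 + t by lra.
have p2 : 0 < 1 - t by lra.
have et : eta = 20 * t by rewrite /t; field.
have [u2|u2] := leP 2 u.
  exists ((1 - t) / (1 + t)), ((1 + eta + t) / (1 - t)); do !split.
  - by rewrite ler_pdivlMr//; lra.
  - by rewrite ler_pdivrMr//; nra.
  - by rewrite lerBrDr ler_pdivlMr// mulrDl divfK ?gt_eqF//; lra.
  - by rewrite ler_pdivlMr//; nra.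
  - by rewrite lerBlDr ler_pdivrMr// mulrDl divfK ?gt_eqF//; lra.
  - rewrite ler_pdivrMr// mulrA mulrAC ler_pdivlMr// et -subr_ge0.
    rewrite (_ : _ - _ = t * (36 - 7 * (20 * t) + 3 * t ^+ 2 * 20)); last by ring.
    by rewrite mulr_ge0 ?(ltW t0)//; rewrite -et; have := sqr_ge0 t; lra.
exists ((1 - eta - t) / (1 + t)), ((1 + t) / (1 - t)); do !split.
- by rewrite ler_pdivlMr//; lra.
- by rewrite ler_pdivrMr//; nra.
- by rewrite lerBrDr ler_pdivlMr// mulrDl divfK ?gt_eqF//; lra.
- by rewrite ler_pdivlMr//; nra.
- by rewrite lerBlDr ler_pdivrMr// mulrDl divfK ?gt_eqF//; lra.
- rewrite ler_pdivrMr// mulrA mulrAC ler_pdivlMr// et -subr_ge0.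
  rewrite (_ : _ - _ = t * (36 - 65 * (20 * t) + 63 * t ^+ 2 * 20)); last by ring.
  by rewrite mulr_ge0 ?(ltW t0)//; rewrite -et; have := sqr_ge0 t; lra.
Qed.

End Deterministic.

(** * The favourable event and the regression quantities *)

Section FiniteInf.
Variables (R : realType) (M : finType).

Lemma inf_image_attained (f : M -> R) (A : set M) m0 : A m0 ->
  exists2 m, A m & inf [set f m | m in A] = f m.
Proof.
move=> Am0; have Pm0 : [pred m | `[< A m >]] m0 by apply/asboolP.
case: (arg_minP f Pm0) => m /asboolP Am m_min.
have lbm : lbound [set f m | m in A] (f m).
  by move=> _ [m' Am' <-]; apply: m_min; apply/asboolP.
exists m => //; apply/eqP; rewrite eq_le; apply/andP; split.
  by apply: ge_inf; [exists (f m) | exists m].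
by apply: lb_le_inf => //; exists (f m), m.
Qed.

End FiniteInf.

Section Deviations.
Context d (T : measurableType d) (R : realType) (P : probability T R).
Variables (n : nat) (sigma : R) (eps : 'I_n -> {RV P >-> R}).
Hypotheses (sigma_gt0 : 0 < sigma) (eps_gaussian : iid_gaussian sigma eps).
Variables (x : R) (F : 'cV[R]_n).
Hypothesis x_gt0 : 0 < x.

Local Notation noise := (noise_vector eps).

Definition residual (S : {vspace 'cV[R]_n}) : 'cV[R]_n := F - orthproj S F.

(** Four one-sided events of probability at most exp (- x) each; they account
    for the factor 4 in the probability bound of the theorem. *)
Definition deviation (S : {vspace 'cV[R]_n}) : set T :=
  [set w | sigma * Num.sqrt (2 * x * dotcv (residual S) (residual S)) <
     dotcv (noise w) (residual S)]%R `|`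
  [set w | sigma * Num.sqrt (2 * x * dotcv (- residual S) (- residual S)) <
     dotcv (noise w) (- residual S)]%R `|`
  [set w | sigma ^+ 2 * ((\dim S)%:R + 2 * Num.sqrt ((\dim S)%:R * x) + 2 * x) <
     enorm (orthproj S (noise w)) ^+ 2]%R `|`
  [set w | enorm (orthproj S (noise w)) ^+ 2 <
     sigma ^+ 2 * ((\dim S)%:R - 2 * Num.sqrt ((\dim S)%:R * x))]%R.

Let measurable_gt (Z : T -> R) t : measurable_fun setT Z ->
  measurable [set w | t < Z w]%R.
Proof.
move=> mZ; have -> : [set w | t < Z w]%R = [set: T] `&` Z @^-1` `]t, +oo[%classic.
  by rewrite setTI; apply/seteqP; split => w /=; rewrite in_itv/= andbT.
exact: mZ.
Qed.

Let measurable_lt (Z : T -> R) t : measurable_fun setT Z ->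
  measurable [set w | Z w < t]%R.
Proof.
move=> mZ; have -> : [set w | Z w < t]%R = [set: T] `&` Z @^-1` `]-oo, t[%classic.
  by rewrite setTI; apply/seteqP; split => w /=; rewrite in_itv.
exact: mZ.
Qed.

Let measurable_sqr_proj (S : {vspace 'cV[R]_n}) :
  measurable_fun setT (fun w => enorm (orthproj S (noise w)) ^+ 2).
Proof.
have [es [_ _ projE]] := orthproj_basis S; under eq_fun do rewrite projE.
by apply: measurable_sum => e; apply: measurable_funX; exact: measurable_dot_noise.
Qed.

Lemma measurable_deviation S : measurable (deviation S).
Proof.
have mdot u := measurable_dot_noise eps u.
have mproj := measurable_sqr_proj S.
by repeat apply: measurableU; [exact: measurable_gt|exact: measurable_gt|
  exact: measurable_gt|exact: measurable_lt].
Qed.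

Lemma deviation_prob S : (P (deviation S) <= (4 * expR (- x))%:E)%E.
Proof.
have mdot u := measurable_dot_noise eps u.
have mproj := measurable_sqr_proj S.
have -> : (4 * expR (- x))%:E =
    ((expR (- x))%:E + (expR (- x))%:E + (expR (- x))%:E + (expR (- x))%:E)%E.
  by rewrite -!EFinD; congr EFin; ring.
have union_bound (A B : set T) (a b : \bar R) : measurable A -> measurable B ->
    (P A <= a)%E -> (P B <= b)%E -> (P (A `|` B) <= a + b)%E.
  move=> mA mB Aa Bb; apply: (@le_trans _ _ (P A + P B)%E); last exact: leeD.
  exact: measureU2.
have mlin u t := measurable_gt t (mdot u).
have mup t := measurable_gt t mproj.
have mlow t := measurable_lt t mproj.
apply: (union_bound); [by do ?apply: measurableU | exact: mlow | |
  exact: sqr_proj_lower_tail].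
apply: (union_bound); [by do ?apply: measurableU | exact: mup | |
  exact: sqr_proj_upper_tail].
apply: (union_bound); [exact: mlin | exact: mlin | |]; exact: linear_tail.
Qed.

Lemma not_deviation S w : ~ deviation S w ->
  concentrated x (enorm (residual S) ^+ 2 / sigma ^+ 2)
    (enorm (orthproj S (noise w)) ^+ 2 / sigma ^+ 2)
    (dotcv (noise w) (residual S) / sigma ^+ 2) (\dim S)%:R.
Proof.
move=> ndev; have s2 : 0 < sigma ^+ 2 by rewrite exprn_gt0.
have [n1 n2 n3 n4] : [/\
    dotcv (noise w) (residual S) <=
      sigma * Num.sqrt (2 * x * dotcv (residual S) (residual S)),
    dotcv (noise w) (- residual S) <=
      sigma * Num.sqrt (2 * x * dotcv (- residual S) (- residual S)),
    enorm (orthproj S (noise w)) ^+ 2 <=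
      sigma ^+ 2 * ((\dim S)%:R + 2 * Num.sqrt ((\dim S)%:R * x) + 2 * x) &
    sigma ^+ 2 * ((\dim S)%:R - 2 * Num.sqrt ((\dim S)%:R * x)) <=
      enorm (orthproj S (noise w)) ^+ 2].
  split; rewrite leNgt; apply/negP => h; apply: ndev; rewrite /deviation;
    [left; left; left|left; left; right|left; right|right]; exact: h.
split; rewrite ?divr_ge0 ?sqr_ge0//.
- exact: ltW.
- have NE u : dotcv (noise w) (- u) = - dotcv (noise w) u.
    by rewrite -scaleN1r dotcvZr mulN1r.
  have NNE : dotcv (- residual S) (- residual S) = dotcv (residual S) (residual S).
    by rewrite -scaleN1r dotcvZl dotcvZr mulrA mulrNN !mul1r.
  rewrite NNE NE in n2; rewrite sqr_enorm.
  rewrite normrM (ger0_norm (_ : 0 <= (sigma ^+ 2)^-1)) ?invr_ge0 ?sqr_ge0//.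
  set U := dotcv (residual S) (residual S) in n1 n2 *.
  have U0 : 0 <= 2 * x * U by rewrite !mulr_ge0 ?dotcv_ge0// ltW.
  have -> : Num.sqrt (2 * x * (U / sigma ^+ 2)) = Num.sqrt (2 * x * U) / sigma.
    by rewrite mulrA sqrtrM// sqrtrV ?sqr_ge0// sqrtr_sqr gtr0_norm.
  rewrite ler_pdivrMr//.
  have -> : Num.sqrt (2 * x * U) / sigma * sigma ^+ 2 =
      sigma * Num.sqrt (2 * x * U) by field; rewrite gt_eqF.
  by rewrite ler_norml n1 lerNl n2.
- by rewrite ler_pdivlMr// mulrC.
- by rewrite ler_pdivrMr// mulrC.
Qed.

End Deviations.

Section RiskDecomposition.
Variables (R : realType) (n : nat) (M : finType).
Variables (S : M -> {vspace 'cV[R]_n}) (F E : 'cV[R]_n).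

Lemma residual_orth m y : y \in S m -> dotcv (residual F (S m)) y = 0.
Proof. exact: orthproj_orth. Qed.

Lemma risk_decomposition m : risk S F m (F + E) =
  (enorm (residual F (S m)) ^+ 2 + enorm (orthproj (S m) E) ^+ 2) / n%:R.
Proof.
rewrite /risk /least_squares; congr (_ / _); rewrite linearD /=.
have -> : orthproj (S m) F + orthproj (S m) E - F =
    orthproj (S m) E - residual F (S m).
  by rewrite /residual opprB addrA [X in X - _]addrC.
have := residual_orth (orthproj_mem (S m) E); move: (residual _ _) => u uE.
rewrite !sqr_enorm dotcvBl !dotcvBr (dotcvC (orthproj _ _) u) uE.
by rewrite subr0 sub0r opprK addrC.
Qed.

Lemma criterion_decomposition C m : criterion S C (F + E) m =
  (enorm (residual F (S m)) ^+ 2 + 2 * dotcv E (residual F (S m))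
   - enorm (orthproj (S m) E) ^+ 2 + C * (\dim (S m))%:R) / n%:R
  + enorm E ^+ 2 / n%:R.
Proof.
rewrite /criterion /emp_risk /least_squares /dimension linearD /=.
have -> : orthproj (S m) F + orthproj (S m) E - (F + E) =
    (orthproj (S m) E - E) - residual F (S m).
  by rewrite /residual opprB opprD addrACA addrC.
have EE := sqr_enorm_orthproj (S m) E; move: EE.
have := residual_orth (orthproj_mem (S m) E).
move: (residual _ _) => u; move: (orthproj _ _) => p up pE.
rewrite (sqr_enorm (_ - _)) !dotcvBl !dotcvBr (dotcvC p u) up (dotcvC p E) -pE.
by rewrite (dotcvC u E) -!sqr_enorm; ring.
Qed.

Lemma bias_residual m : bias S F m = enorm (residual F (S m)) ^+ 2 / n%:R.
Proof. by rewrite /bias add_lfunE opp_lfunE id_lfunE. Qed.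

Lemma residual_fullv : residual F fullv = 0.
Proof.
rewrite /residual (@orthproj_unique _ _ _ _ F) ?memvf ?subrr// => z _.
by rewrite dotcvC dotcv0r.
Qed.

End RiskDecomposition.

(** From ln n = 2 ln (sqrt n) <= 2 sqrt n. *)
Lemma ln_over_n_small (R : realType) (gamma c : R) : 0 <= gamma -> 0 < c ->
  exists n0 : nat, forall n, (n0 <= n)%N ->
    (1 < n)%N /\ Num.sqrt (gamma * ln n%:R / n%:R) <= c.
Proof.
move=> g0 c0; pose K := (2 * gamma / c ^+ 2) ^+ 2.
exists (maxn 2 (Num.truncn K).+1) => n; rewrite geq_max => /andP[n1 nK].
have n0 : 0 < n%:R :> R by rewrite ltr0n (ltn_trans _ n1).
split => //; rewrite -(ger0_norm (ltW c0)) -sqrtr_sqr ler_sqrt ?sqr_ge0//.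
pose r : R := Num.sqrt n%:R; have r0 : 0 < r by rewrite sqrtr_gt0.
have r2 : n%:R = r ^+ 2 :> R by rewrite sqr_sqrtr// ltW.
have Kr : 2 * gamma / c ^+ 2 <= r.
  have p0 : 0 <= 2 * gamma / c ^+ 2 by rewrite divr_ge0 ?sqr_ge0// mulr_ge0.
  rewrite -(ger0_norm p0) -sqrtr_sqr ler_sqrt ?(ltW n0)// -/K.
  by apply: le_trans (ltW (truncnS_gt K)) _; rewrite ler_nat.
have ln_le : ln n%:R <= 2 * r.
  by rewrite r2 lnXn// -[ln r *+ 2]mulr_natl ler_pM2l// ltW// ln_sublinear.
rewrite ler_pdivrMr//; apply: le_trans (ler_wpM2l g0 ln_le) _; rewrite r2.
rewrite ler_pdivrMr ?exprn_gt0// in Kr.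
have := ler_wpM2r (ltW r0) Kr; rewrite !expr2; lra.
Qed.

(** * Model selection *)

Lemma finite_union_bound d (T : measurableType d) (R : realType)
    (P : probability T R) (M : finType) (B : M -> set T) (c : R) :
  (forall m, measurable (B m)) -> (forall m, (P (B m) <= c%:E)%E) ->
  (P (\big[setU/set0]_m B m) <= (#|M|%:R * c)%:E)%E.
Proof.
move=> mB Bc; rewrite mulr_natl -[X in X%:E]sumr_const.
elim: (index_enum M) => [|m s IHs]; first by rewrite !big_nil measure0.
rewrite !big_cons EFinD; apply: (@le_trans _ _
  (P (B m) + P (\big[setU/set0]_(m <- s) B m))%E); last exact: leeD.
by apply: measureU2 => //; exact: bigsetU_measurable.
Qed.

Theorem theorem1 (R : realType) (gamma : R) (gamma_ge0 : 0 <= gamma) :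
  exists n0 : nat,
  forall (n : nat) (M : finType) (S : M -> {vspace 'cV[R]_n})
    (F : 'cV[R]_n) (sigma : R)
    (d : measure_display) (T : measurableType d) (P : probability T R)
    (eps : 'I_n -> {RV P >-> R}) (mhat : R -> T -> M),
  let Y w := F + \col_i eps i w in
  (n0 <= n)%N ->
  0 < sigma ->
  (exists m0, dimension S m0 <= n%:R / 20) ->
  (exists m1, S m1 = fullv) ->
  iid_gaussian sigma eps ->
  (forall C w, 0 <= C -> argmin_criterion S C (Y w) (mhat C w)) ->
  exists A : set T,
    [/\ measurable A,
        ((1 - 4 * #|M|%:R * n%:R `^ (- gamma))%:E <= P A)%E &
        forall w, A w ->
        [/\ forall C, 0 <= C -> C <= (1 - eta_minus n gamma) * sigma ^+ 2 ->
              9 * n%:R / 10 <= dimension S (mhat C w),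
            forall C, 0 <= C -> C <= (1 - eta_minus n gamma) * sigma ^+ 2 ->
              7 * sigma ^+ 2 / 8 <= risk S F (mhat C w) (Y w),
            forall C, 0 <= C -> (1 + eta_plus S F sigma gamma) * sigma ^+ 2 <= C ->
              dimension S (mhat C w) <= n%:R / 10,
            forall C, sigma ^+ 2 < C ->
              risk S F (mhat C w) (Y w) <=
              slope_factor (C / sigma ^+ 2) *
              (oracle_risk S F (Y w)
               + 20 * sigma ^+ 2 * gamma * ln n%:R / n%:R) &
            forall eta C, 0 < eta <= 1 / 2 ->
              (2 - eta) * sigma ^+ 2 <= C <= (2 + eta) * sigma ^+ 2 ->
              risk S F (mhat C w) (Y w) <=
              (1 + 3 * eta) * oracle_risk S F (Y w)
              + 880 * sigma ^+ 2 * gamma * ln n%:R / (eta * n%:R)]].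
Proof.
have c0 : 0 < 80^-1 :> R by rewrite invr_gt0.
have [n0 n0P] := ln_over_n_small gamma_ge0 c0.
exists n0 => n M S F sigma d T P eps mhat Y n0n s0 [m0 m0_small] [m1 m1_full].
move=> gauss argmin.
have [n1 q_le] := n0P n n0n.
have n_gt0 : 0 < n%:R :> R by rewrite ltr0n (ltn_trans _ n1).
move: gamma_ge0; rewrite le_eqVlt => /predU1P[gamma0|gamma_gt0].
  (* For gamma = 0 the probability bound is at most 1 - 4 card M < 0. *)
  exists set0; split => //; rewrite measure0 lee_fin -gamma0 oppr0 powRr0 mulr1.
  have : 1 <= #|M|%:R :> R by rewrite ler1n; apply/card_gt0P; exists m0.
  lra.
pose x := gamma * ln n%:R.
have x_gt0 : 0 < x by rewrite mulr_gt0// ln_gt0// ltr1n.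
have expx : n%:R `^ (- gamma) = expR (- x).
  by rewrite /powR gt_eqF// mulNr.
pose q := Num.sqrt (x / n%:R).
have q_gt0 : 0 < q by rewrite sqrtr_gt0 divr_gt0.
have xq : x = q ^+ 2 * n%:R by rewrite sqr_sqrtr ?divfK ?gt_eqF ?divr_ge0 ?ltW.
have q_range : 0 < q <= 80^-1 by rewrite q_gt0.
have s2 : 0 < sigma ^+ 2 by rewrite exprn_gt0.
pose B m := deviation sigma eps x F (S m).
have mB m : measurable (B m) by exact: measurable_deviation.
have mU : measurable (\big[setU/set0]_m B m) by exact: bigsetU_measurable.
exists (~` \big[setU/set0]_m B m); split.
- exact: measurableC.
- rewrite probability_setC// expx EFinB leeB//.
  have -> : 4 * #|M|%:R * expR (- x) = #|M|%:R * (4 * expR (- x)) by ring.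
  by apply: finite_union_bound => // m; exact: deviation_prob.
move=> w Aw; pose E := noise_vector eps w.
have YE : Y w = F + E by [].
pose b m := enorm (residual F (S m)) ^+ 2 / sigma ^+ 2.
pose v m := enorm (orthproj (S m) E) ^+ 2 / sigma ^+ 2.
pose g m := dotcv E (residual F (S m)) / sigma ^+ 2.
pose D m : R := (\dim (S m))%:R.
have conc m : concentrated (q ^+ 2 * n%:R) (b m) (v m) (g m) (D m).
  rewrite -xq; apply: not_deviation => // Bw; apply: Aw.
  by rewrite -bigcup_seq; exists m => //=; rewrite mem_index_enum.
have D_le m : D m <= n%:R.
  rewrite ler_nat -[leqRHS](muln1 n) -[(n * 1)%N](dim_matrix R n 1) -dimvf.
  exact/dimvS/subvf.
have riskE m : risk S F m (Y w) = sigma ^+ 2 * ((b m + v m) / n%:R).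
  by rewrite YE risk_decomposition /b /v; field; rewrite !gt_eqF.
have opt C m' : 0 <= C ->
    b (mhat C w) + 2 * g (mhat C w) - v (mhat C w)
      + C / sigma ^+ 2 * D (mhat C w) <=
    b m' + 2 * g m' - v m' + C / sigma ^+ 2 * D m'.
  move=> C0; have := argmin C w C0 m'.
  rewrite YE !criterion_decomposition lerD2r ler_pM2r ?invr_gt0//.
  rewrite -(ler_pM2r (_ : 0 < (sigma ^+ 2)^-1)) ?invr_gt0// => h.
  apply: le_trans (le_trans _ h) _; rewrite le_eqVlt; apply/orP; left; apply/eqP;
  rewrite /b /g /v /D; ring.
have oracle_le C m' h k :
    b (mhat C w) + v (mhat C w) <= h * (b m' + v m') + k * (q ^+ 2 * n%:R) ->
    risk S F (mhat C w) (Y w) <= h * risk S F m' (Y w) + sigma ^+ 2 * k * x / n%:R.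
  move=> hk; rewrite !riskE.
  have -> : h * (sigma ^+ 2 * ((b m' + v m') / n%:R)) + sigma ^+ 2 * k * x / n%:R =
      sigma ^+ 2 / n%:R * (h * (b m' + v m') + k * (q ^+ 2 * n%:R)).
    by rewrite xq; field; rewrite gt_eqF.
  rewrite mulrA mulrAC ler_pM2l//; first by rewrite divr_gt0.
have [m' _ oracleE] := inf_image_attained
  (fun m => risk S F m (Y w)) (I : setT m0).
rewrite /oracle_risk oracleE.
have small_dim C : 0 <= C -> C <= (1 - eta_minus n gamma) * sigma ^+ 2 ->
    9 * n%:R / 10 <= D (mhat C w).
  move=> C0; rewrite -ler_pdivrMr// => hC.
  have Dm1 : D m1 = n%:R by rewrite /D m1_full dimvf dim_matrix mulr1.
  have bm1 : b m1 = 0.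
    by rewrite /b m1_full residual_fullv sqr_enorm dotcv0r mul0r.
  have cm1 := conc m1; have om1 := opt C m1 C0; rewrite Dm1 in cm1 om1.
  exact: (small_penalty_dimension n_gt0 q_range (conc _) cm1 bm1 (D_le _) hC om1).
split.
- exact: small_dim.
- move=> C C0 hC; rewrite riskE.
  have := large_dimension_risk n_gt0 (_ : 0 <= q <= 80^-1) (conc _) (D_le _)
    (small_dim C C0 hC).
  rewrite (ltW q_gt0) => /(_ q_le) h.
  rewrite [leLHS](_ : _ = sigma ^+ 2 * (7 / 8)); last by ring.
  by rewrite ler_pM2l// ler_pdivlMr.
- move=> C C0; rewrite -ler_pdivlMr// => hC.
  have [m2 m2_small infE] := @inf_image_attained R M (bias S F)
    [set m | dimension S m <= n%:R / 20] m0 m0_small.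
  apply: (large_penalty_dimension n_gt0 q_range (conc _) (conc m2) (D_le _)
    m2_small _ (opt C m2 C0)).
  apply: le_trans hC; rewrite /eta_plus infE bias_residual le_eqVlt.
  apply/orP; left; apply/eqP; rewrite -/x -/q /b.
  by field; rewrite !gt_eqF.
- move=> C hC; have C0 : 0 <= C by exact: ltW (lt_trans s2 hC).
  have u1 : 1 < C / sigma ^+ 2 by rewrite ltr_pdivlMr// mul1r.
  have := slope_risk (conc _) (conc m') u1 (opt C m' C0).
  rewrite mulrDr mulrA => /oracle_le/le_trans; apply.
  rewrite le_eqVlt; apply/orP; left; apply/eqP; rewrite /x; ring.
- move=> eta C eta_range /andP[Cl Cr].
  have C0 : 0 <= C.
    by apply: le_trans Cl; rewrite mulr_ge0 ?sqr_ge0//; lra.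
  have u2 : 2 - eta <= C / sigma ^+ 2 <= 2 + eta.
    by rewrite ler_pdivlMr// ler_pdivrMr// Cl.
  have := near_two_risk (conc _) (conc m') eta_range u2 (opt C m' C0).
  move=> /oracle_le/le_trans; apply.
  rewrite le_eqVlt; apply/orP; left; apply/eqP; rewrite /x.
  by field; rewrite !gt_eqF//; lra.
Qed.
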